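(* Let $W(\cdot)$ be a sample-path continuous, intrinsically stationary Gaussian random field on $\mathbb{R}^d$ with variogram $\gamma$, mean $0$ and variance $\sigma^2(\cdot)$, such that $\lim_{|t|\to\infty}\left(W(t)-\frac{\sigma^2(t)}{2}\right)=-\infty$ almost surely. Let $\lambda^*\in(0,\infty)$ and the probability measure $Q$ on $C(\mathbb{R}^d)$ be the constant and the probability measure associated with $W$ as defined in the context. Let $\Pi:=\sum_{i\in\mathbb{N}}\delta_{(S_i,U_i)}$ be a Poisson point process on $\mathbb{R}^d\times\mathbb{R}$ with intensity measure $\lambda^*e^{-u}\,du\,ds$, and let $\tilde F_i$, $i\in\mathbb{N}$, be i.i.d. with law $Q$, independent of $\Pi$. Then $$Z_{4,\lambda^*}(t):=\max_{i\in\mathbb{N}}\left(U_i+\tilde F_i(t-S_i)\right),\qquad t\in\mathbb{R}^d,$$ is a Brown-Resnick process associated to the variogram $\gamma$, i.e. $Z_{4,\lambda^*}(\cdot)\stackrel{d}{=}Z(\cdot)$, where $Z$ is the Brown-Resnick process associated to $\gamma$.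
   Context: A random field $W$ on $\mathbb{R}^d$ is intrinsically stationary if for every $h$ the field $\{W(x+h)-W(x)\}_x$ is weakly stationary; its (semi-)variogram is $\gamma(h)=\frac12\mathbb{E}(W(h)-W(0))^2$. $C(\mathbb{R}^d)$ is the space of continuous functions $\mathbb{R}^d\to\mathbb{R}$ with the $\sigma$-algebra generated by the evaluation maps. Definition of $\lambda^*$ and $Q$: let $W_i$, $i\in\mathbb{N}$, be independent copies of $W$ and $\sum_i\delta_{X_i}$ an independent Poisson point process on $\mathbb{R}$ with intensity measure $e^{-x}dx$. Put $T_i=\inf\big(\mathrm{argsup}_{t\in\mathbb{R}^d}(W_i(t)-\sigma^2(t)/2)\big)$ (smallest maximizer, with respect to the lexicographic order if $d>1$), $M_i=\sup_{t\in\mathbb{R}^d}(W_i(t)-\sigma^2(t)/2)$ and $F_i(\cdot)=W_i(\cdot+T_i)-\sigma^2(\cdot+T_i)/2-M_i$. Then $\sum_i\delta_{(T_i,X_i+M_i,F_i)}$ is a Poisson point process on $\mathbb{R}^d\times\mathbb{R}\times C(\mathbb{R}^d)$ with intensity measure of the form $\lambda^*\,dt\times e^{-y}dy\times Q(df)$ with $0<\lambda^*<\infty$ and $Q$ a probability measure on $C(\mathbb{R}^d)$; this determines $\lambda^*$ and $Q$. The Brown-Resnick process associated to $\gamma$ is $Z(t)=\max_{i\in\mathbb{N}}\big(X_i+W_i(t)-\frac{\sigma^2(t)}{2}\big)$, $t\in\mathbb{R}^d$, with $X_i,W_i$ as just described; it is a stationary max-stable process with standard Gumbel margins whose law depends only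 on $\gamma$. $\stackrel{d}{=}$ denotes equality of all finite-dimensional distributions. *)

(* Defs.v *)
From HB Require Import structures.
From mathcomp Require Import all_boot all_order all_algebra.
From mathcomp Require Import all_classical all_reals all_analysis.
From mathcomp Require Import measurable_realfun.

Set Implicit Arguments.
Unset Strict Implicit.
Unset Printing Implicit Defensive.

Import Order.TTheory GRing.Theory Num.Theory.
Import numFieldNormedType.Exports.

Local Open Scope classical_set_scope.
Local Open Scope ring_scope.

(* The Borel sigma-algebra of R^d, presented (as the library does for tuples)
   as the sigma-algebra generated by the coordinates. *)
Section measurable_rV.
Variables (R : realType) (d : nat).

Let coors : 'I_d -> 'rV[R]_d -> R := fun i x => x ord0 i.

Let rV_set0 : g_sigma_preimage coors set0.
Proof. exact: sigma_algebra0. Qed.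

Let rV_setC A : g_sigma_preimage coors A -> g_sigma_preimage coors (~` A).
Proof. exact: sigma_algebraC. Qed.

Let rV_bigcup (F : _^nat) : (forall i, g_sigma_preimage coors (F i)) ->
  g_sigma_preimage coors (\bigcup_i (F i)).
Proof. exact: sigma_algebra_bigcup. Qed.

HB.instance Definition _ := @isMeasurable.Build default_measure_display
  'rV[R]_d (g_sigma_preimage coors) rV_set0 rV_setC rV_bigcup.

Lemma measurable_coord (i : 'I_d) :
  measurable_fun setT (fun x : 'rV[R]_d => x ord0 i).
Proof.
move=> _ Y mY; apply: sub_sigma_algebra.
by rewrite (bigD1 i)//=; left; exists Y.
Qed.

Lemma measurable_fun_rV d' (T : measurableType d') (f : T -> 'rV[R]_d) :
  (forall i, measurable_fun setT (fun x => f x ord0 i)) ->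
  measurable_fun setT f.
Proof.
move=> mf; pose G := \big[setU/set0]_(i < d)
  preimage_set_system setT (coors i) measurable.
apply: (@measurability _ _ _ _ setT f G) => //.
move=> _ [B + <-]; rewrite /G -bigcup_seq => -[i _ [Y mY <-]].
by rewrite !setTI; have := mf i measurableT Y mY; rewrite setTI.
Qed.

End measurable_rV.

Definition cons_rV (R : realType) n (p : R * 'rV[R]_n) : 'rV[R]_n.+1 :=
  \row_(i < n.+1) if unlift ord0 i is Some j then p.2 ord0 j else p.1.

Definition uncons_rV (R : realType) n (x : 'rV[R]_n.+1) : R * 'rV[R]_n :=
  (x ord0 ord0, \row_j x ord0 (lift ord0 j)).

Lemma cons_rVK (R : realType) n : cancel (@cons_rV R n) (@uncons_rV R n).
Proof.
case=> a x; congr pair; first by rewrite mxE unlift_none.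
by apply/rowP => j; rewrite !mxE liftK.
Qed.

Lemma measurable_cons_rV (R : realType) n :
  measurable_fun setT (@cons_rV R n).
Proof.
apply: measurable_fun_rV => i; rewrite /cons_rV.
under eq_fun do rewrite mxE.
case: unliftP => [j _|_]; last exact: measurable_fst.
exact: (measurableT_comp (measurable_coord _) measurable_snd).
Qed.

Lemma measurable_uncons_rV (R : realType) n :
  measurable_fun setT (@uncons_rV R n).
Proof.
apply/measurable_fun_pairP; split; first exact: measurable_coord.
apply: measurable_fun_rV => i; under eq_fun do rewrite /= mxE.
exact: measurable_coord.
Qed.

Section lebesgue_rV_step.
Local Open Scope ereal_scope.
Variables (R : realType) (n : nat).
Variable m : {sigma_finite_measure set 'rV[R]_n -> \bar R}.

Let leb : {sigma_finite_measure set (measurableTypeR R) -> \bar R} :=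
  @lebesgue_measure R.

Let mu : {measure set (measurableTypeR R * 'rV[R]_n)%type -> \bar R} :=
  leb \x m.

Let mu_sigma_finite : sigma_finite setT mu.
Proof.
exact: (isSigmaFinite.sigma_finiteT
  (lebesgue_integral_fubini.measure_function_Measure_isSigmaFinite__to__measure_function_isSigmaFinite leb m)).
Qed.

Definition lebesgue_rV_step : set 'rV[R]_n.+1 -> \bar R :=
  pushforward mu (@cons_rV R n).

Let step0 : lebesgue_rV_step set0 = 0.
Proof. exact: (measure0 mu). Qed.

Let step_ge0 A : 0 <= lebesgue_rV_step A.
Proof. exact: (measure_ge0 mu). Qed.

Let mpre A : measurable A -> measurable (@cons_rV R n @^-1` A).
Proof.
by move=> mA; rewrite -[X in measurable X]setTI; exact: measurable_cons_rV.
Qed.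

Let step_sigma_additive : semi_sigma_additive lebesgue_rV_step.
Proof.
move=> F mF tF mUF; rewrite /lebesgue_rV_step /pushforward preimage_bigcup.
apply: (measure_semi_sigma_additive (s := mu)).
- by move=> i; exact: mpre.
- apply/trivIsetP => i j _ _ ij; rewrite -preimage_setI.
  move/trivIsetP : tF => /(_ _ _ Logic.I Logic.I ij) ->.
  by rewrite preimage_set0.
- by rewrite -preimage_bigcup; exact: mpre.
Qed.

HB.instance Definition _ := isMeasure.Build _ _ _ lebesgue_rV_step
  step0 step_ge0 step_sigma_additive.

Let step_sigma_finite : sigma_finite setT lebesgue_rV_step.
Proof.
have [F TF Foo] := mu_sigma_finite.
exists (fun k => @uncons_rV R n @^-1` F k).
  by rewrite -preimage_bigcup -TF preimage_setT.
move=> k; have [mF Fk] := Foo k; split.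
  by rewrite -[X in measurable X]setTI; exact: measurable_uncons_rV.
by rewrite /lebesgue_rV_step /pushforward -comp_preimage
  (_ : _ \o _ = idfun)//; apply/funext; exact: cons_rVK.
Qed.

HB.instance Definition _ := Measure_isSigmaFinite.Build _ _ _ lebesgue_rV_step
  step_sigma_finite.

End lebesgue_rV_step.

(* Lebesgue measure on R^n, as an iterated product. *)
Fixpoint lebesgue_rV (R : realType) (n : nat) :
    {sigma_finite_measure set 'rV[R]_n -> \bar R} :=
  if n is k.+1 then lebesgue_rV_step (lebesgue_rV R k)
  else dirac (0 : 'rV[R]_0).

Section expN_measure.
Local Open Scope ereal_scope.
Variable R : realType.

(* e^{-x} dx *)
Definition expN_measure (A : set R) : \bar R :=
  \int[lebesgue_measure]_(x in A) (expR (- x))%:E.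

Let mexpN (A : set R) : measurable A ->
  measurable_fun A (fun x : R => (expR (- x))%:E).
Proof.
move=> mA; apply/measurable_EFinP.
apply: (@measurable_funS _ _ _ _ setT) => //.
exact: measurableT_comp.
Qed.

Let expN0 : expN_measure set0 = 0.
Proof. exact: integral_set0. Qed.

Let expN_ge0 A : 0 <= expN_measure A.
Proof. by apply: integral_ge0 => x _; rewrite lee_fin expR_ge0. Qed.

Let expN_sigma_additive : semi_sigma_additive expN_measure.
Proof.
move=> F mF tF mUF.
have -> : expN_measure (\bigcup_n F n) = \sum_(n <oo) expN_measure (F n).
  rewrite /expN_measure ge0_integral_bigcup//.
  exact: mexpN.
apply/cvg_closeP; split; last by rewrite closeE.
by apply: is_cvg_nneseries => n _ _; exact: expN_ge0.
Qed.

HB.instance Definition _ := isMeasure.Build _ _ _ expN_measure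
  expN0 expN_ge0 expN_sigma_additive.

Let expN_sigma_finite : sigma_finite setT expN_measure.
Proof.
exists (fun n => [set` `[(- n%:R)%R : R, n%:R%R]]).
  apply/seteqP; split => // x _; exists (Num.truncn `|x|%R).+1 => //=.
  by rewrite in_itv/= -ler_norml ltW// truncnS_gt.
move=> n; split => //.
apply: (@le_lt_trans _ _
  (\int[lebesgue_measure]_(x in [set` `[(- n%:R)%R : R, n%:R%R]])
    cst (expR n%:R)%:E x)).
  apply: ge0_le_integral => //=.
  - exact: mexpN.
  - move=> x; rewrite /= in_itv/= => /andP[nx _].
    by rewrite lee_fin ler_expR lerNl.
rewrite integral_cst//= lebesgue_measure_itv/=.
by case: ifP => _; rewrite -?EFinB -?EFinM ?mule0 ?ltry.
Qed.

HB.instance Definition _ := Measure_isSigmaFinite.Build _ _ _ expN_measure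
  expN_sigma_finite.

End expN_measure.

Notation C_Rd R d := (continuousType 'rV[R]_d R).

(* C(R^d) carries the sigma-algebra generated by the evaluation maps. *)
Section measurable_continuous.
Variables (R : realType) (d : nat).

Let evals : set (set (continuousType 'rV[R]_d R)) :=
  \bigcup_t preimage_set_system setT
    (fun f : continuousType 'rV[R]_d R => f t) measurable.

HB.instance Definition _ := isPointed.Build (continuousType 'rV[R]_d R)
  (cst 0 : continuousType 'rV[R]_d R).

HB.instance Definition _ := @isMeasurable.Build default_measure_display
  (continuousType 'rV[R]_d R) <<s evals >> (@sigma_algebra0 _ setT evals)
  (@sigma_algebraC _ evals) (@sigma_algebra_bigcup _ setT evals).

End measurable_continuous.

Section independence.
Context d (T : measurableType d) (R : realType) (P : probability T R).

Definition mutual_indep (I : eqType) (F : I -> set (set T)) : Prop :=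
  forall (s : seq I) (A : I -> set T), uniq s ->
    (forall i, i \in s -> F i (A i)) ->
    P (\big[setI/setT]_(i <- s) A i) = (\prod_(i <- s) P (A i))%E.

Definition sigma_of d' (E : measurableType d') (X : T -> E) : set (set T) :=
  preimage_set_system setT X measurable.

Definition sigma_of_seq d' (E : measurableType d') (X : nat -> T -> E) :
    set (set T) :=
  <<s \bigcup_k sigma_of (X k) >>.

(* The sequence X (as a whole), Y_0, Y_1, Y_2, ... are mutually independent;
   index None stands for X. *)
Definition indep_of_seq d1 d2 (E1 : measurableType d1) (E2 : measurableType d2)
    (X : nat -> T -> E1) (Y : nat -> T -> E2) : Prop :=
  mutual_indep (fun o : option nat =>
    if o is Some i then sigma_of (Y i) else sigma_of_seq X).

(* (sum_i delta_{X_i})(A) *)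
Definition point_count d' (E : measurableType d') (X : nat -> T -> E)
    (A : set E) (w : T) : \bar R :=
  (\sum_(i <oo) \d_(X i w) A)%E.

(* The total mass of mu may be infinite; the points are indexed by all of nat,
   so the definition can only be met when it is. The (unused) second argument
   of poisson_prob is a library artefact. *)
Definition poisson_process d' (E : measurableType d') (X : nat -> T -> E)
    (mu : set E -> \bar R) : Prop :=
  [/\ forall i, measurable_fun setT (X i),
      forall A k, measurable A -> (mu A < +oo)%E ->
        P [set w | point_count X A w = k%:R%:E] =
          poisson_prob (fine (mu A)) k [set k],
      forall A, measurable A -> mu A = +oo%E ->
        P [set w | point_count X A w = +oo%E] = 1%E
    & forall n (A : 'I_n -> set E), (forall j, measurable (A j)) ->
        trivIset setT A ->
        mutual_indep (fun j => sigma_of (point_count X (A j)))].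

End independence.

Section gaussian_fields.
Context d0 (T : measurableType d0) (R : realType) (P : probability T R).
Variable d : nat.
Implicit Type Y : 'rV[R]_d -> T -> R.

(* possibly degenerate: N(m, 0) is the Dirac mass at m *)
Definition gaussian_rv (X : T -> R) : Prop :=
  exists m s : R, forall A : set R, measurable A ->
    P (X @^-1` A) = if s == 0 then \d_m A else normal_prob m s A.

Definition gaussian_field Y : Prop :=
  forall n (t : 'I_n -> 'rV[R]_d) (a : 'I_n -> R),
    gaussian_rv (fun w => \sum_(i < n) a i * Y (t i) w).

Definition weakly_stationary Y : Prop :=
  [/\ forall x, Y x \in Lfun P 2%:E,
      forall x y, 'E_P[Y x]%E = 'E_P[Y y]%E
    & forall x y h, covariance P (Y (x + h)) (Y (y + h)) =
                    covariance P (Y x) (Y y)].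

Definition intrinsically_stationary Y : Prop :=
  forall h, weakly_stationary (fun x w => Y (x + h) w - Y x w).

Definition variogram Y (h : 'rV[R]_d) : \bar R :=
  ((2^-1)%:E * 'E_P[fun w => ((Y h w - Y 0 w) ^+ 2)%R])%E.

End gaussian_fields.

(* lexicographic order on R^d *)
Definition lexle (R : realType) d (x y : 'rV[R]_d) : Prop :=
  x = y \/ exists i : 'I_d, x ord0 i < y ord0 i /\
    forall j : 'I_d, (j < i)%N -> x ord0 j = y ord0 j.

Definition is_argsup (R : realType) d (g : 'rV[R]_d -> R) (t : 'rV[R]_d) :=
  forall s, g s <= g t.

Definition is_lex_argsup (R : realType) d (g : 'rV[R]_d -> R) t : Prop :=
  is_argsup g t /\ forall s, is_argsup g s -> lexle t s.

(* The fields are extended-real valued because pointwise maxima of infinite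
   families are taken as suprema in \bar R. *)
Definition equal_fdd d1 d2 (T1 : measurableType d1) (T2 : measurableType d2)
    (R : realType) (P1 : probability T1 R) (P2 : probability T2 R) (U : Type)
    (Y1 : U -> T1 -> \bar R) (Y2 : U -> T2 -> \bar R) : Prop :=
  forall n (t : n.-tuple U) (B : set (n.-tuple (\bar R))), measurable B ->
    P1 [set w | B [tuple Y1 (tnth t i) w | i < n]] =
    P2 [set w | B [tuple Y2 (tnth t i) w | i < n]].

(* W_0, W_1, ... are independent copies of W, independent of the Poisson point
   process sum_i delta_{X_i} with intensity e^{-x} dx. *)
Definition BR_system (R : realType) d d0 d1 (T0 : measurableType d0)
    (T1 : measurableType d1) (P0 : probability T0 R) (W : {RV P0 >-> C_Rd R d})
    (P1 : probability T1 R) (W1 : nat -> {RV P1 >-> C_Rd R d})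
    (X : nat -> T1 -> R) : Prop :=
  [/\ forall i A, measurable A ->
        distribution P1 (W1 i) A = distribution P0 W A,
      poisson_process P1 X (@expN_measure R)
    & indep_of_seq P1 X W1].

(* Main.v *)
Require Import Defs.
From HB Require Import structures.
From mathcomp Require Import all_boot all_order all_algebra finmap.
From mathcomp Require Import all_classical all_reals all_analysis.
From mathcomp Require Import measurable_realfun ring lra.

Set Implicit Arguments.
Unset Strict Implicit.
Unset Printing Implicit Defensive.

Import Order.TTheory GRing.Theory Num.Theory.
Import numFieldNormedType.Exports.

Local Open Scope classical_set_scope.
Local Open Scope ring_scope.

(** The statement compares two maxima over point processes. The event that such
    a maximum stays below thresholds y_1, ..., y_n at sites t_1, ..., t_n says
    that no point of the process lies in a certain exceedance set, so finite
    dimensional distributions are void probabilities. For a Poisson process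
    with independent marks, the void probability of a measurable set A is
    exp (- nu A), where nu is the product of the intensity and the mark law
    (marked_void); hence everything reduces to comparing intensities of
    exceedance sets.

    For Z the relevant points are (X_i, W_i), for Z4 they are
    ((S_i, U_i), F~_i), of intensity lambda ds e^(-u) du Q(df). The link
    between the two is the system (X_i, W_i) seen from its maximisers: writing
    X_i + W_i t - sigma2 t / 2 = (X_i + M_i) + F_i (t - T_i), the points
    (T_i, X_i + M_i, F_i) exceed the thresholds exactly when the points
    (X_i, W_i) do, and they form by assumption a Poisson process of that very
    intensity. Its void probability is therefore at once
    exp (- lambda (leb x expN x Q) A) and the void probability of the marked
    process (X_i, W_i), which depends only on the law of W (M3_exponentE).
    Distribution functions at finitely many sites determine all finite
    dimensional distributions (equal_fdd_cdf).

    The void probability of a marked process is obtained from Laplace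
    functionals: integrating out the independent marks one at a time turns
    E exp (- sum_i h (X_i, G_i)) into E exp (- sum_i k (X_i)) with
    e^(- k x) = E e^(- h (x, G)) (expectation_marks), and the Laplace functional
    of the unmarked process follows from the generating function of Poisson
    counts and their independence, first for simple functions and then by
    monotone limits (laplace_functional).

    That the supremum is attained comes from the same formula. The exponent at
    a single site t and threshold y is e^(- y) times a constant which is finite
    because W t is Gaussian (BR_exponent1, gaussian_exp_moment): being finite,
    it leaves almost surely finitely many points above any level; tending to
    infinity as y decreases, it forces a point above some level (M3_attained).
*)

(** * Independence and averaging *)

Section independence_extension.
Local Open Scope ereal_scope.
Context d (T : measurableType d) (R : realType) (P : probability T R).

Lemma sigma_of_measurable d' (E : measurableType d') (Y : T -> E) :
  measurable_fun setT Y -> sigma_of Y `<=` measurable.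
Proof. by move=> mY _ [A mA <-]; exact: mY. Qed.

Lemma setI_closed_sigma_of d' (E : measurableType d') (Y : T -> E) :
  setI_closed (sigma_of Y).
Proof.
move=> _ _ [A mA <-] [B mB <-]; exists (A `&` B); first exact: measurableI.
by rewrite !setTI.
Qed.

Lemma sigma_of_setT d' (E : measurableType d') (Y : T -> E) :
  sigma_of Y setT.
Proof. by exists setT => //; rewrite setTI. Qed.

(** Mutual independence, stated for individual events of the family, extends to
    an event of the sigma-algebra generated by finitely many members: finite
    intersections form a pi-system, on which two finite measures agree. *)
Lemma mutual_indep_generated (I : eqType) (F : I -> set (set T)) (s : seq I)
    (i : I) :
  mutual_indep P F -> (forall j, F j `<=` measurable) ->
  (forall j, setI_closed (F j)) -> (forall j, F j setT) -> uniq (i :: s) ->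
  forall D E, <<s \bigcup_(j in [set` s]) F j >> D -> F i E ->
  P (D `&` E) = P D * P E.
Proof.
move=> indF mF FI FT /= /andP[iNs us] D E DF FiE.
pose G := [set D | exists2 A : I -> set T, (forall j, j \in s -> F j (A j)) &
  D = \big[setI/setT]_(j <- s) A j].
have mG : G `<=` measurable.
  move=> _ [A FA ->]; rewrite big_seq.
  by apply: bigsetI_measurable => j js; exact: (mF j _ (FA j js)).
have sub : <<s \bigcup_(j in [set` s]) F j >> `<=` <<s G >>.
  apply: smallest_sub; first exact: smallest_sigma_algebra.
  move=> B [j /= js FB]; apply: sub_sigma_algebra; rewrite /G/=.
  exists (fun k => if k == j then B else setT).
    by move=> k _; case: eqP => [->|_].
  rewrite (bigD1_seq j)//= eqxx big1 ?setIT// => k /negbTE ->//.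
have mE : measurable E := mF i _ FiE.
have PE0 : (0 <= fine (P E))%R by exact: fine_ge0.
pose m2 := mscale (NngNum PE0) P.
have m2E B : m2 B = P B * P E.
  transitivity ((fine (P E))%:E * P B); first by [].
  by rewrite fineK ?fin_num_measure// muleC.
transitivity (m2 D); last exact: m2E.
rewrite -[LHS]/(mrestr P mE D).
apply: (g_sigma_algebra_measure_unique G mG (fun=> setT)) => //.
- move=> _; exists (fun=> setT); first by move=> j _.
  by rewrite big1.
- by rewrite bigcup_const.
- move=> _ _ [A FA ->] [B FB ->]; exists (fun j => A j `&` B j).
    by move=> j js; apply: FI; [exact: FA|exact: FB].
  by rewrite big_split.
- move=> _ [A FA ->]; rewrite [RHS]m2E /mrestr.
  pose A' j := if j == i then E else A j.
  have A'E : forall j, j \in s -> A' j = A j.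
    by move=> j js; rewrite /A'; case: eqP js => // ->; rewrite (negbTE iNs).
  have bigA' : \big[setI/setT]_(j <- s) A' j = \big[setI/setT]_(j <- s) A j.
    exact: eq_big_seq.
  have prodA' : \prod_(j <- s) P (A' j) = \prod_(j <- s) P (A j).
    by apply: eq_big_seq => j /A'E ->.
  have us' : uniq (i :: s) by rewrite /= iNs.
  have FA' j : j \in i :: s -> F j (A' j).
    rewrite in_cons /A'; case: eqVneq => [->//|ji /= js]; exact: FA.
  have := indF (i :: s) A' us' FA'.
  rewrite !big_cons bigA' prodA' {1 2}/A' eqxx => indA'.
  transitivity (P (E `&` \big[setI/setT]_(j <- s) A j)); first by rewrite setIC.
  by rewrite indA' muleC (indF s A us FA).
- move=> _; rewrite /mrestr.
  by rewrite (le_lt_trans (probability_le1 _ _)) ?ltry//; exact: measurableI.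
- exact: sub.
Qed.

(** Given the events of H, the independent variable Y may be replaced by a fresh
    copy: the joint law of the identity, valued in T with the sigma-algebra
    generated by H, and of Y is a product, and Tonelli applies. That phi is
    measurable for this coarser sigma-algebra is what makes its first argument
    independent of Y. *)
Lemma independent_freezing (H : set (set T)) d' (E : measurableType d')
    (Y : T -> E) (phi : g_sigma_algebraType H * E -> \bar R) :
  H `<=` measurable -> measurable_fun setT Y ->
  (forall D C, <<s H >> D -> measurable C ->
    P (D `&` Y @^-1` C) = P D * P (Y @^-1` C)) ->
  measurable_fun setT phi -> (forall z, 0 <= phi z) ->
  \int[P]_w phi (w, Y w) = \int[P]_w \int[P]_w' phi (w, Y w').
Proof.
move=> Hm mY indY mphi phi0.
pose gT := g_sigma_algebraType H.
have mid : measurable_fun setT (idfun : T -> gT).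
  move=> _ B mB; rewrite setTI preimage_id.
  have sub : <<s H >> `<=` @measurable _ T.
    by apply: smallest_sub => //; exact: sigma_algebra_measurable.
  exact: sub.
pose idT : {RV P >-> gT} := mfun_Sub (mem_set mid).
pose YT : {RV P >-> E} := mfun_Sub (mem_set mY).
have mj : measurable_fun setT (fun w => (idT w, YT w)).
  by apply/measurable_fun_pairP; split.
pose J : {RV P >-> (gT * E)%type} := mfun_Sub (mem_set mj).
transitivity (\int[distribution P J]_z phi z).
  by rewrite ge0_integral_distribution.
transitivity (\int[distribution P idT \x distribution P YT]_z phi z).
  apply: eq_measure_integral => A mA _; apply/esym.
  by apply: product_measure_unique => // B C mB mC; exact: indY.
rewrite fubini_tonelli1//=.
rewrite ge0_integral_distribution//=; last first.
- by move=> y; exact: integral_ge0.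
- exact: measurable_fun_fubini_tonelli_F.
apply: eq_integral => w _; rewrite /= /fubini_F ge0_integral_distribution//.
by apply: measurableT_comp => //; exact: measurable_pair1.
Qed.

Lemma emeasurable_prod d0 (T0 : measurableType d0) (I : eqType)
    (f : I -> T0 -> \bar R) (s : seq I) :
  (forall j, j \in s -> measurable_fun setT (f j)) ->
  measurable_fun setT (fun x => \prod_(j <- s) f j x).
Proof.
elim: s => [_|i s ih mf].
  by under eq_fun do rewrite big_nil; exact: measurable_cst.
under eq_fun do rewrite big_cons.
apply: emeasurable_funM; first by apply: mf; rewrite mem_head.
by apply: ih => j js; apply: mf; rewrite in_cons js orbT.
Qed.

Lemma expectation_prod_indep d' (E : measurableType d') (I : eqType)
    (N : I -> T -> E) (f : I -> E -> \bar R) (s : seq I) :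
  mutual_indep P (fun j => sigma_of (N j)) ->
  (forall j, measurable_fun setT (N j)) ->
  (forall j, measurable_fun setT (f j)) -> (forall j x, 0 <= f j x) ->
  uniq s ->
  \int[P]_w (\prod_(j <- s) f j (N j w)) =
  \prod_(j <- s) \int[P]_w f j (N j w).
Proof.
move=> indN mN mf f0; elim: s => [_|i s ih us].
  rewrite big_nil; under eq_integral do rewrite big_nil.
  by rewrite integral_cst//= probability_setT mule1.
rewrite big_cons; under eq_integral do rewrite big_cons.
pose H := \bigcup_(j in [set` s]) sigma_of (N j).
have sigmam j : sigma_of (N j) `<=` measurable.
  exact: sigma_of_measurable.
pose phi (z : g_sigma_algebraType H * E) :=
  f i z.2 * \prod_(j <- s) f j (N j z.1).
have mNH j : j \in s -> measurable_fun setT (N j : g_sigma_algebraType H -> E).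
  move=> js _ B mB; apply: sub_sigma_algebra.
  by exists j => //; exists B.
rewrite (@independent_freezing H _ _ (N i) phi)//=.
- transitivity (\int[P]_w
      ((\int[P]_w' f i (N i w')) * \prod_(j <- s) f j (N j w))).
    apply: eq_integral => w _; rewrite /phi/= ge0_integralZr//.
    + exact: measurableT_comp.
    + by apply: prode_ge0.
  rewrite ge0_integralZl//.
  + by rewrite ih//; case/andP : us.
  + by apply: emeasurable_prod => j _; exact: measurableT_comp.
  + by move=> w _; exact: prode_ge0.
  + exact: integral_ge0.
- by move=> B [j _]; exact: sigmam.
- move=> D C HD mC; apply: (mutual_indep_generated indN _ _ _ us) => //.
  + by move=> j; exact: setI_closed_sigma_of.
  + by move=> j; exact: sigma_of_setT.
  + by exists C => //; rewrite setTI.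
- apply: emeasurable_funM; first exact: measurableT_comp.
  apply: emeasurable_prod => j js; apply: measurableT_comp => //.
  exact: (measurableT_comp (mNH j js) measurable_fst).
- by move=> z; apply: mule_ge0 => //; exact: prode_ge0.
Qed.

End independence_extension.

Section marks.
Local Open Scope ereal_scope.
Context d (T : measurableType d) (R : realType) (P : probability T R).
Context d1 d2 (E1 : measurableType d1) (E2 : measurableType d2).
Variables (X : nat -> T -> E1) (G : nat -> T -> E2) (Q : probability E2 R).
Hypothesis mX : forall i, measurable_fun setT (X i).
Hypothesis mG : forall i, measurable_fun setT (G i).
Hypothesis G_law : forall i A, measurable A -> P (G i @^-1` A) = Q A.
Hypothesis G_indep : indep_of_seq P X G.

Let XT := g_sigma_algebraType (\bigcup_k sigma_of (X k)).

Lemma integral_mark i (x : E1) (g : E1 * E2 -> \bar R) :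
  measurable_fun setT g -> (forall z, 0 <= g z) ->
  \int[P]_w g (x, G i w) = \int[Q]_c g (x, c).
Proof.
move=> mg g0; pose Gi : {RV P >-> E2} := mfun_Sub (mem_set (mG i)).
have mgx : measurable_fun setT (fun c => g (x, c)).
  exact: measurable_fun_pair2.
transitivity (\int[distribution P Gi]_c g (x, c)).
  by rewrite ge0_integral_distribution.
by apply: eq_measure_integral => A mA _; exact: G_law.
Qed.

(** Marks can be integrated out one at a time, because G_k is independent of
    the process X together with G_0, ..., G_(k-1). The weight psi, a function of
    X only, collects the factors whose mark has been averaged already. *)
Lemma expectation_marks (g : E1 * E2 -> \bar R) k (psi : XT -> \bar R) :
  measurable_fun setT g -> (forall z, 0 <= g z) ->
  measurable_fun setT psi -> (forall w, 0 <= psi w) ->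
  \int[P]_w (psi w * \prod_(i < k) g (X i w, G i w)) =
  \int[P]_w (psi w * \prod_(i < k) \int[Q]_c g (X i w, c)).
Proof.
move=> mg g0; elim: k psi => [|k ih] psi mpsi psi0.
  by apply: eq_integral => w _; rewrite !big_ord0.
pose F (o : option nat) :=
  if o is Some i then sigma_of (G i) else sigma_of_seq X.
pose s : seq (option nat) := None :: [seq Some i | i <- iota 0 k].
pose H := \bigcup_(j in [set` s]) F j.
have mFsub j : F j `<=` measurable.
  case: j => [i|]; first exact: sigma_of_measurable.
  apply: smallest_sub; first exact: sigma_algebra_measurable.
  by move=> A [i _]; exact: sigma_of_measurable.
have FI j : setI_closed (F j).
  case: j => [i|]; first exact: setI_closed_sigma_of.
  by move=> A B mA mB; exact: (@measurableI _ XT).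
have FT j : F j setT.
  case: j => [i|]; first exact: sigma_of_setT.
  exact: (@measurableT _ XT).
(* None indexes the whole sequence X, Some i the mark G_i *)
have us : uniq (Some k :: s).
  have injS : injective (@Some nat) by move=> a b [].
  rewrite /s !cons_uniq map_inj_uniq// iota_uniq andbT in_cons/= mem_map//.
  by rewrite mem_iota add0n ltnn andbF/=; apply/mapP => -[].
have indH D C : <<s H >> D -> measurable C ->
    P (D `&` G k @^-1` C) = P D * P (G k @^-1` C).
  move=> HD mC; apply: (mutual_indep_generated G_indep _ _ _ us) => //.
  by exists C => //; rewrite setTI.
pose HT := g_sigma_algebraType H.
have mpsiH : measurable_fun setT (psi : HT -> \bar R).
  move=> _ A mA; apply: sub_sigma_algebra; exists None; first by [].
  exact: mpsi.
have mXH i : measurable_fun setT (X i : HT -> E1).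
  move=> _ A mA; apply: sub_sigma_algebra; exists None; first by [].
  by apply: sub_sigma_algebra; exists i => //; exists A.
have mGH (i : 'I_k) : measurable_fun setT (G i : HT -> E2).
  move=> _ A mA; apply: sub_sigma_algebra; exists (Some (i : nat)).
    by rewrite /s/= in_cons/= mem_map ?mem_iota//= => a b [].
  by exists A.
pose psik (w : HT) := psi w * \prod_(i < k) g (X i w, G i w).
have mpsik : measurable_fun setT psik.
  apply: emeasurable_funM => //; apply: emeasurable_prod => i _.
  by apply: (measurableT_comp mg); exact: measurable_fun_pair.
have psik0 w : 0 <= psik w by rewrite mule_ge0// prode_ge0.
pose phi (z : HT * E2) := psik z.1 * g (X k z.1, z.2).
have mphi : measurable_fun setT phi.
  apply: emeasurable_funM; first exact: measurableT_comp.
  apply: (measurableT_comp mg); apply: measurable_fun_pair => //.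
  exact: (measurableT_comp (mXH k) measurable_fst).
pose ghat x := \int[Q]_c g (x, c).
have mghat : measurable_fun setT ghat.
  exact: measurable_fun_fubini_tonelli_F.
have ghat0 x : 0 <= ghat x by apply: integral_ge0 => c _.
transitivity (\int[P]_w phi (w, G k w)).
  by apply: eq_integral => w _; rewrite big_ord_recr/= muleA.
rewrite (independent_freezing _ (mG k) indH)//; last 2 first.
- by move=> A [j _]; exact: mFsub.
- by move=> z; rewrite mule_ge0.
transitivity (\int[P]_w ((psi w * ghat (X k w)) *
    \prod_(i < k) g (X i w, G i w))).
  apply: eq_integral => w _; rewrite /phi/= ge0_integralZl//; last first.
  - exact: (measurableT_comp (measurable_fun_pair2 (X k w) mg) (mG k)).
  by rewrite integral_mark// /psik muleAC.
rewrite (ih (fun w => psi w * ghat (X k w)))//.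
- by apply: eq_integral => w _; rewrite big_ord_recr/= muleA muleAC.
- apply: emeasurable_funM => //; apply: measurableT_comp => //.
  move=> _ A mA; apply: sub_sigma_algebra.
  by exists k => //; exists A.
- by move=> w; rewrite mule_ge0.
Qed.

End marks.

(** * Exponentials of extended reals and Poisson weights *)

Section expeN.
Local Open Scope ereal_scope.
Context {R : realType}.
Implicit Types x y : \bar R.

(** Extended to [0, +oo] by e^(-oo) = 0, so that sums with infinite terms and
    sets of infinite intensity need no separate treatment. *)
Definition expeN x := expeR (- x).

Lemma expeN_ge0 x : 0 <= expeN x. Proof. exact: expeR_ge0. Qed.

Lemma expeN0 : expeN 0 = 1. Proof. by rewrite /expeN oppe0 expeR0. Qed.

Lemma expeN_le1 x : 0 <= x -> expeN x <= 1.
Proof. by move=> x0; rewrite -expeN0 lee_expeR leeN2. Qed.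

Lemma expeND x y : 0 <= x -> 0 <= y -> expeN (x + y) = expeN x * expeN y.
Proof. by move=> x0 y0; rewrite /expeN oppeD ?expeRD// ge0_adde_def. Qed.

Lemma expeN_inj : injective expeN.
Proof. by move=> x y /expeR_inj /oppe_inj. Qed.

Lemma expeN_sum (I : Type) (s : seq I) (f : I -> \bar R) :
  (forall i, 0 <= f i) ->
  expeN (\sum_(i <- s) f i) = \prod_(i <- s) expeN (f i).
Proof.
move=> f0; elim: s => [|i s ih]; first by rewrite !big_nil expeN0.
by rewrite !big_cons expeND ?ih// sume_ge0.
Qed.

Lemma expeN_fin_num x : 0 <= x -> expeN x \is a fin_num.
Proof.
move=> x0; rewrite ge0_fin_numE ?expeN_ge0//.
by rewrite (le_lt_trans (expeN_le1 x0))// ltry.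
Qed.

Lemma measurable_expeN : measurable_fun setT expeN.
Proof.
rewrite (_ : expeN = fun x => if x == +oo then 0 else
    if x == -oo then +oo else (expR (- fine x))%:E); last first.
  by apply/funext => -[].
apply: measurable_fun_ifT => //; first exact: measurable_fun_eqe.
apply: measurable_fun_ifT => //; first exact: measurable_fun_eqe.
apply/measurable_EFinP; apply: measurableT_comp => //.
by apply: measurableT_comp => //; exact: fine_measurable.
Qed.

Lemma cvg_expeN (u : (\bar R)^nat) (l : \bar R) : 0 <= l ->
  u @ \oo --> l -> expeN (u n) @[n --> \oo] --> expeN l.
Proof.
case: l => [l _|_|//].
  move=> /fine_cvgP[ufin ul].
  apply: (@cvg_trans _ ((expR (- fine (u n)))%:E @[n --> \oo])).
    apply: near_eq_cvg; near=> n.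
    have : u n \is a fin_num by near: n.
    by case: (u n).
  apply: cvg_EFin; first exact: nearW.
  exact: (cvg_comp _ _ (cvgN ul) (@continuous_expR R _)).
move=> /cvgeyPge uy; rewrite /expeN/=; apply/fine_cvgP; split.
  near=> n; have : (0%R)%:E <= u n by near: n; exact: uy.
  by case: (u n).
apply/cvgr0Pnorm_le => e e0; near=> n.
have : (- ln e)%:E <= u n by near: n; exact: uy.
rewrite /=; case: (u n) => [r| |]//=; last by move=> _; rewrite normr0 ltW.
rewrite lee_fin lerNl => re; rewrite ger0_norm ?expR_ge0//.
by rewrite -[leRHS](@lnK _ e)// ler_expR.
Unshelve. all: by end_near. Qed.

Lemma measurable_lne : measurable_fun setT (@lne R).
Proof.
rewrite (_ : @lne R = fun x => if x == +oo then +oo else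
    if x <= 0 then -oo else (ln (fine x))%:E); last first.
  by apply/funext => -[r| |]//=; rewrite ?lee_fin ?leNye.
apply: measurable_fun_ifT => //; first exact: measurable_fun_eqe.
apply: measurable_fun_ifT => //; first exact: measurable_fun_lee.
apply/measurable_EFinP; apply: measurableT_comp; first exact: measurable_ln.
exact: fine_measurable.
Qed.

End expeN.

Section poisson_pgf.
Local Open Scope ereal_scope.
Context {R : realType}.

(** Exponential tilting: weighting a Poisson law by c^k multiplies its rate by c,
    up to a normalising factor. Summing over k gives the generating function. *)
Lemma poisson_probZ (m c : R) k : (0 <= m)%R -> (0 < c)%R ->
  (c ^+ k)%:E * poisson_prob m k [set k] =
  poisson_prob (c * m) k [set k] * (expR (- ((1 - c) * m)))%:E.
Proof.
rewrite le_eqVlt => /predU1P[<- c0|m0 c0]; rewrite /poisson_prob.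
  rewrite !mulr0 ltxx oppr0 expR0 mule1 diracE.
  by case: k => [|k]; rewrite ?expr0 ?mul1e// memNset ?mule0//= => /eqP.
rewrite m0 mulr_gt0// !esum_set1 ?lee_fin ?poisson_pmf_ge0//.
rewrite /poisson_pmf m0 mulr_gt0// -!EFinM; congr EFin.
rewrite -[RHS]mulrA -expRD (_ : - (c * m) - (1 - c) * m = - m)%R; last by ring.
by rewrite exprMn; ring.
Qed.

Lemma poisson_prob_total (m : R) :
  \sum_(k <oo) poisson_prob m k [set k] = 1.
Proof.
transitivity (\sum_(k <oo) poisson_prob m 0%N [set k]); first by [].
rewrite -(@probability_setT _ _ _ (poisson_prob m 0%N)).
rewrite (_ : setT = \bigcup_k [set k])%classic; last first.
  by apply/seteqP; split => // k _; exists k.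
rewrite measure_bigcup//; first by apply: eq_eseriesl => k; rewrite in_setT.
by move=> i j _ _ [x []] /= -> ->.
Qed.

End poisson_pgf.

(** * Laplace functionals of Poisson processes *)

Section point_counts.
Local Open Scope ereal_scope.
Context d (T : measurableType d) (R : realType).
Context d' (E : measurableType d').

Lemma measurable_point_count (X : nat -> T -> E) A :
  (forall i, measurable_fun setT (X i)) -> measurable A ->
  measurable_fun setT (point_count R X A : T -> \bar R).
Proof.
move=> mX mA; apply: ge0_emeasurable_sum; first by move=> *; exact: measure_ge0.
move=> i _; rewrite (_ : (fun w => _) = (fun w => (\1_(X i @^-1` A) w)%:E)).
  apply/measurable_EFinP/measurable_indic.
  by rewrite -[X in measurable X]setTI; exact: mX.
by apply/funext => w; rewrite diracE indicE.
Qed.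

(** The counting measure of the points, so that sums over points are integrals
    and inherit monotone convergence. *)
Definition point_measure (X : nat -> T -> E) (w : T) :
    {measure set E -> \bar R} :=
  mseries (fun i => \d_(X i w)) 0.

Lemma integral_point_measure (X : nat -> T -> E) w (h : E -> \bar R) :
  measurable_fun setT h -> (forall x, 0 <= h x) ->
  \int[point_measure X w]_x h x = \sum_(i <oo) h (X i w).
Proof.
move=> mh h0; rewrite ge0_integral_measure_series//.
by apply: eq_eseriesr => i _; rewrite integral_dirac// diracT mul1e.
Qed.

End point_counts.

Section poisson_count.
Local Open Scope ereal_scope.
Context d (T : measurableType d) (R : realType) (P : probability T R).
Lemma probability1_integral (A : set T) (f : T -> \bar R) :
  measurable A -> P A = 1 -> measurable_fun setT f -> (forall w, 0 <= f w) ->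
  \int[P]_w f w = \int[P]_(w in A) f w.
Proof.
move=> mA PA mf f0.
rewrite (ge0_negligible_integral (N := ~` A))//.
- by rewrite setTD setCK.
- exact: measurableC.
- by have := probability_setC P mA; rewrite PA subee.
Qed.

Context d' (E : measurableType d') (X : nat -> T -> E).
Variable mu : {measure set E -> \bar R}.
Hypothesis XP : poisson_process P X mu.

Lemma poisson_process_measurable i : measurable_fun setT (X i).
Proof. by case: XP. Qed.
Local Notation mX := poisson_process_measurable.

Lemma measurable_laplace_count t A : (0 <= t)%R -> measurable A ->
  measurable_fun setT (fun w => expeN (t%:E * point_count R X A w)).
Proof.
move=> t0 mA; apply: measurableT_comp; first exact: measurable_expeN.
by apply: measurable_funeM; apply: measurable_point_count => // i; exact: mX.
Qed.

(** When mu A is infinite both sides vanish unless t = 0, in which case they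
    equal 1. Otherwise the count is almost surely one of the integers, over
    which the integral splits into a tilted Poisson sum. *)
Lemma poisson_count_pgf t A : (0 <= t)%R -> measurable A ->
  \int[P]_w expeN (t%:E * point_count R X A w) =
  expeN ((1 - expR (- t))%:E * mu A).
Proof.
move=> t0 mA; pose N := point_count R X A : T -> \bar R.
have mN : measurable_fun setT N.
  by apply: measurable_point_count => // i; exact: mX.
have mNl x : measurable [set w | N w = x].
  rewrite (_ : [set _ | _] = setT `&` N @^-1` [set x]); last by rewrite setTI.
  exact: mN.
have mf := measurable_laplace_count t0 mA.
have [muA|muA] := eqVneq (mu A) +oo.
  have [-> |tn0] := eqVneq t 0%R.
    rewrite oppr0 expR0 subrr mul0e expeN0.
    under eq_integral do rewrite mul0e expeN0.
    by rewrite integral_cst//= probability_setT mule1.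
  have tgt0 : (0 < t)%R by rewrite lt_neqAle eq_sym tn0.
  have PN : P [set w | N w = +oo] = 1 by case: XP => _ _ /(_ A mA muA) ->.
  rewrite (probability1_integral (mNl _) PN)//; last first.
    by move=> w; exact: expeN_ge0.
  rewrite muA gt0_muley; last first.
    by rewrite lte_fin subr_gt0 expR_lt1 oppr_lt0.
  rewrite /expeN/= integral0_eq// => w /= Nw.
  by rewrite -/(N w) Nw gt0_muley ?lte_fin.
have fmuA : mu A < +oo by rewrite ltey.
have [m m0 muE] : exists2 m, (0 <= m)%R & mu A = m%:E.
  by exists (fine (mu A)); rewrite ?fine_ge0// fineK// ge0_fin_numE.
have Nk k : P [set w | N w = k%:R%:E] = poisson_prob m k [set k].
  by case: XP => _ /(_ A k mA fmuA) + _ _; rewrite muE.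
pose B k := [set w | N w = k%:R%:E].
have tB : trivIset setT B.
  move=> i j _ _ [w [/= Bi Bj]]; apply/eqP; rewrite -(@eqr_nat R).
  by move: Bi; rewrite /B/= Bj => -[->].
have PB : P (\bigcup_k B k) = 1.
  rewrite measure_bigcup//=; last by move=> k _; exact: mNl.
  rewrite -(poisson_prob_total m).
  by under eq_eseriesl do rewrite in_setT; apply: eq_eseriesr => k _; exact: Nk.
rewrite (probability1_integral _ PB)//; first last.
- by move=> w; exact: expeN_ge0.
- by apply: bigcupT_measurable => k; exact: mNl.
rewrite ge0_integral_bigcup//; first last.
- by move=> w _; exact: expeN_ge0.
- exact: measurable_funTS.
- by move=> k; exact: mNl.
have c0 : (0 < expR (- t))%R by exact: expR_gt0.
rewrite muE [RHS]/expeN/=.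
rewrite -[RHS]mule1 -(poisson_prob_total (expR (- t) * m)) -nneseriesZl//.
apply: eq_eseriesr => k _.
rewrite (eq_integral (cst (expR (- t) ^+ k)%:E)); last first.
  move=> w /[!inE] /= Nw; rewrite -/(N w) Nw /expeN/=.
  by rewrite -expRM_natr mulNr.
rewrite integral_cst//; last exact: mNl.
transitivity ((expR (- t) ^+ k)%:E * poisson_prob m k [set k]).
  by congr (_ * _); exact: Nk.
by rewrite poisson_probZ// muleC.
Qed.

End poisson_count.

Section laplace_functional.
Local Open Scope ereal_scope.
Context d' (E : measurableType d') (R : realType).
Import HBNNSimple.

(** Requiring f to be nonnegative everywhere keeps all terms of the sum
    nonnegative; a nonnegative h is recovered with f the absolute value. *)
Lemma integral_comp_nnsfun (m : {measure set E -> \bar R})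
    (h : {nnsfun E >-> R}) (f : R -> R) : (forall y, 0 <= f y)%R ->
  \int[m]_x (f (h x))%:E =
  \sum_(y <- fset_set (range h)) (f y)%:E * m (h @^-1` [set y]).
Proof.
move=> f0.
transitivity (\int[m]_x \sum_(y <- fset_set (range h))
    (f y)%:E * (\1_(h @^-1` [set y]) x)%:E).
  apply: eq_integral => x _.
  rewrite (bigD1_seq (h x))/=; last 2 first.
  - by rewrite in_fset_set// inE; exists x.
  - exact: fset_uniq.
  rewrite indicE mem_set// mule1 big1 ?adde0// => y yhx.
  rewrite indicE memNset ?mule0//= => /esym hxy.
  by move: yhx; rewrite hxy eqxx.
rewrite ge0_integral_sum//.
- apply: eq_bigr => y _; rewrite ge0_integralZl//.
  + by rewrite integral_indic// setIT.
  + exact/measurable_EFinP/measurable_indic.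
  + by rewrite lee_fin.
- by move=> y; apply/measurable_funeM/measurable_EFinP/measurable_indic.
- by move=> y x _; rewrite mule_ge0// lee_fin.
Qed.

Context d (T : measurableType d) (P : probability T R).
Variables (X : nat -> T -> E) (mu : {measure set E -> \bar R}).
Hypothesis XP : poisson_process P X mu.
Let mX := poisson_process_measurable XP.

(** The level sets of h are disjoint, so the counts of points on them are
    independent and the expectation factors into generating functions. *)
Lemma laplace_nnsfun (h : {nnsfun E >-> R}) :
  \int[P]_w expeN (\sum_(i <oo) (h (X i w))%:E) =
  expeN (\int[mu]_x (1 - expeN (h x)%:E)).
Proof.
pose s : seq R := fset_set (range h).
pose a (j : 'I_(size s)) := tnth (in_tuple s) j.
pose A j := h @^-1` [set a j].
have us : uniq s by exact: fset_uniq.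
have mA j : measurable (A j) by rewrite /A.
have tA : trivIset setT A.
  move=> i j _ _ [x [/= hi hj]]; apply: (elimT (tuple_uniqP (in_tuple s)) us).
  by rewrite -/(a i) -/(a j) -hi -hj.
have hnorm x : h x = `|h x|%R by rewrite ger0_norm.
transitivity (\int[P]_w \prod_(j < size s)
    expeN (`|a j|%:E * point_count R X (A j) w)).
  apply: eq_integral => w _.
  rewrite -(@integral_point_measure _ _ R _ _ X w (fun x => (h x)%:E))//=;
    first last.
  - by move=> x; rewrite lee_fin.
  - exact/measurable_EFinP.
  under eq_integral do rewrite hnorm.
  rewrite (integral_comp_nnsfun _ _ (@normr_ge0 _ _))// expeN_sum.
    by rewrite [LHS]big_tnth.
  by move=> j; rewrite mule_ge0// lee_fin.
transitivity (\prod_(j < size s)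
    \int[P]_w expeN (`|a j|%:E * point_count R X (A j) w)).
  apply: (@expectation_prod_indep _ _ _ P _ _ _
    (fun j => point_count R X (A j)) (fun j x => expeN (`|a j|%:E * x))).
  - by case: XP => _ _ _ /(_ _ A mA tA).
  - by move=> j; apply: measurable_point_count.
  - move=> j; apply: measurableT_comp; first exact: measurable_expeN.
    exact: measurable_funeM.
  - by move=> j x; exact: expeN_ge0.
  - by rewrite index_enum_uniq.
transitivity (\prod_(j < size s) expeN ((1 - expR (- `|a j|))%:E * mu (A j))).
  by apply: eq_bigr => j _; apply: poisson_count_pgf.
rewrite -expeN_sum; last first.
  by move=> j; rewrite mule_ge0// lee_fin subr_ge0 expR_le1 oppr_le0.
congr expeN.
transitivity (\int[mu]_x (1 - expR (- `|h x|))%:E); last first.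
  by apply: eq_integral => x _; rewrite -hnorm EFinB.
rewrite (integral_comp_nnsfun _ _ (f := fun y => 1 - expR (- `|y|))%R).
  by rewrite [RHS]big_tnth.
by move=> y; rewrite subr_ge0 expR_le1 oppr_le0.
Qed.

Lemma expectation_expeN_cvg (Y : nat -> T -> \bar R) (L : T -> \bar R) :
  (forall n, measurable_fun setT (Y n)) -> measurable_fun setT L ->
  (forall n w, 0 <= Y n w) -> (forall w, 0 <= L w) ->
  (forall w, Y n w @[n --> \oo] --> L w) ->
  \int[P]_w expeN (Y n w) @[n --> \oo] --> \int[P]_w expeN (L w).
Proof.
move=> mY mL Y0 L0 YL.
have mexp (Z : T -> \bar R) : measurable_fun setT Z ->
    measurable_fun setT (fun w => expeN (Z w)).
  by move=> mZ; apply: measurableT_comp mZ; exact: measurable_expeN.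
have := @dominated_convergence _ _ _ P setT measurableT
  (fun n w => expeN (Y n w)) (fun w => expeN (L w)) (cst 1).
case => //.
- by move=> n; exact: mexp.
- exact: mexp.
- by apply: aeW => w _; exact: cvg_expeN.
- exact: finite_measure_integrable_cst.
- by apply: aeW => w n _; rewrite gee0_abs ?expeN_ge0// expeN_le1.
Qed.

Lemma laplace_functional (h : E -> \bar R) :
  measurable_fun setT h -> (forall x, 0 <= h x) ->
  \int[P]_w expeN (\sum_(i <oo) h (X i w)) =
  expeN (\int[mu]_x (1 - expeN (h x))).
Proof.
move=> mh h0; pose hn := nnsfun_approx measurableT mh.
have hnh x : (hn n x)%:E @[n --> \oo] --> h x.
  by apply: cvg_nnsfun_approx => // y _; exact: h0.
have nd_hn x : {homo (fun n => (hn n x)%:E) : m n / (m <= n)%N >-> m <= n}.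
  by move=> m n mn; rewrite lee_fin; exact/lefP/nd_nnsfun_approx.
have mhn n : measurable_fun setT (fun x => (hn n x)%:E).
  exact/measurable_EFinP.
have mexp n : measurable_fun setT (fun x => 1 - expeN (hn n x)%:E).
  apply: emeasurable_funB => //.
  by apply: measurableT_comp (mhn n); exact: measurable_expeN.
have cvg_lhs : \int[P]_w expeN (\sum_(i <oo) (hn n (X i w))%:E) @[n --> \oo]
    --> \int[P]_w expeN (\sum_(i <oo) h (X i w)).
  apply: expectation_expeN_cvg.
  - move=> n; apply: ge0_emeasurable_sum => [i x _ _|i _].
      by rewrite lee_fin.
    exact: (measurableT_comp (mhn n)).
  - apply: ge0_emeasurable_sum => [//|i _].
    exact: (measurableT_comp mh (mX i)).
  - by move=> n w; apply: nneseries_ge0 => i _ _; rewrite lee_fin.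
  - by move=> w; apply: nneseries_ge0.
  - move=> w; rewrite -(@integral_point_measure _ _ R _ _ X w h)//.
    rewrite (_ : (fun n => \sum_(i <oo) (hn n (X i w))%:E) =
        fun n => \int[point_measure R X w]_x (hn n x)%:E); last first.
      apply/funext => n; rewrite integral_point_measure// => x.
      by rewrite lee_fin.
    rewrite (_ : (fun x => h x) = fun x => limn (fun n => (hn n x)%:E)).
      by apply: cvg_monotone_convergence => // n x _; rewrite lee_fin.
    by apply/funext => x; apply/esym/cvg_lim.
have cvg_rhs : expeN (\int[mu]_x (1 - expeN (hn n x)%:E)) @[n --> \oo]
    --> expeN (\int[mu]_x (1 - expeN (h x))).
  apply: cvg_expeN.
    by apply: integral_ge0 => x _; rewrite sube_ge0 ?expeN_le1// expeN_fin_num.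
  rewrite (_ : (fun x => 1 - expeN (h x)) =
      fun x => limn (fun n => 1 - expeN (hn n x)%:E)).
    apply: cvg_monotone_convergence => //.
    - by move=> n x _; rewrite sube_ge0 ?expeN_le1 ?expeN_fin_num ?lee_fin.
    - move=> x _ m n mn; rewrite leeB// /expeN lee_expeR leeN2.
      exact: nd_hn.
  apply/funext => x; apply/esym/cvg_lim => //.
  apply: cvgeB; [by []|exact: cvg_cst|exact: cvg_expeN].
rewrite -(cvg_lim _ cvg_lhs)// -(cvg_lim _ cvg_rhs)//.
by apply: congr_lim; apply/funext => n; exact: laplace_nnsfun.
Qed.

End laplace_functional.

(** * Points falling in a set *)

Section hitting.
Local Open Scope ereal_scope.
Context d (T : measurableType d) (R : realType) (P : probability T R).
Context d' (E : measurableType d') (Y : nat -> T -> E).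
Hypothesis mY : forall i, measurable_fun setT (Y i).
Implicit Types (A : set E) (t : \bar R).

(** Summed over the points of a process, this is t times the number of points
    in A. The value t = +oo detects a single point. *)
Definition mass_on t A (x : E) : \bar R := t * (\1_A x)%:E.

Lemma mass_on_ge0 t A x : 0 <= t -> 0 <= mass_on t A x.
Proof. by move=> t0; rewrite mule_ge0// lee_fin. Qed.

Lemma measurable_mass_on t A : measurable A -> measurable_fun setT (mass_on t A).
Proof.
by move=> mA; apply/measurable_funeM/measurable_EFinP/measurable_indic.
Qed.

Lemma one_minus_expeN_mass_on t A x :
  1 - expeN (mass_on t A x) = (1 - expeN t) * (\1_A x)%:E.
Proof.
rewrite /mass_on indicE; case: (x \in A); first by rewrite !mule1.
by rewrite !mule0 expeN0 subee.
Qed.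

Lemma measurable_miss A : measurable A ->
  measurable [set w | forall i, ~ A (Y i w)].
Proof.
move=> mA; rewrite (_ : [set _ | _] = \bigcap_i (Y i @^-1` (~` A))).
  apply: bigcapT_measurable => i; rewrite -[X in measurable X]setTI.
  by apply: mY => //; exact: measurableC.
by apply/seteqP; split => [w h i _|w h i]; [exact: h|exact: (h i Logic.I)].
Qed.

Lemma measurable_eventually_miss A : measurable A ->
  measurable [set w | exists n, forall i, (n <= i)%N -> ~ A (Y i w)].
Proof.
move=> mA; rewrite (_ : [set _ | _] =
    \bigcup_n \bigcap_(i in [set i | (n <= i)%N]) (Y i @^-1` (~` A))).
  apply: bigcupT_measurable => n; apply: bigcap_measurable.
    by exists n => /=.
  move=> i _; rewrite -[X in measurable X]setTI.
  by apply: mY => //; exact: measurableC.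
apply/seteqP; split => [w [n h]|w [n _ h]]; first by exists n.
by exists n => i ni; exact: (h i ni).
Qed.

Lemma le_tail_nneseries (f : nat -> \bar R) N i :
  (forall n, 0 <= f n) -> (N <= i)%N -> f i <= \sum_(N <= n <oo) f n.
Proof.
move=> f0 Ni; apply: (@le_trans _ _ (\sum_(N <= n < i.+1) f n)); last first.
  exact: nneseries_lim_ge.
by rewrite big_nat_recr//= leeDr// sume_ge0.
Qed.

Lemma measurable_expeN_hits t A : 0 <= t -> measurable A ->
  measurable_fun setT (fun w => expeN (\sum_(i <oo) mass_on t A (Y i w))).
Proof.
move=> t0 mA; apply: measurableT_comp; first exact: measurable_expeN.
apply: ge0_emeasurable_sum => [i x _ _|i _]; first exact: mass_on_ge0.
exact: (measurableT_comp (measurable_mass_on _ mA)).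
Qed.

Lemma expectation_hit_oo A : measurable A ->
  \int[P]_w expeN (\sum_(i <oo) mass_on +oo A (Y i w)) =
  P [set w | forall i, ~ A (Y i w)].
Proof.
move=> mA; transitivity (\int[P]_w
    (\1_[set w | forall i, ~ A (Y i w)] w)%:E); last first.
  by rewrite integral_indic ?setIT//; exact: measurable_miss.
apply: eq_integral => w _; rewrite indicE.
have [miss|hit] := pselect (forall i, ~ A (Y i w)).
  rewrite mem_set// eseries0 ?expeN0// => i _ _.
  by rewrite /mass_on indicE memNset ?mule0.
rewrite memNset//; move/existsNP : hit => [i /contrapT Ai].
suff -> : \sum_(i <oo) mass_on +oo A (Y i w) = +oo by [].
apply/eqP; rewrite -leye_eq.
have := @le_tail_nneseries (fun i => mass_on +oo A (Y i w)) 0 i.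
rewrite /mass_on indicE mem_set// mule1; exact.
Qed.

(** If infinitely many points fall in A the sum is infinite and its negative
    exponential vanishes. *)
Lemma expectation_hit_le t A : 0 < t -> measurable A ->
  \int[P]_w expeN (\sum_(i <oo) mass_on t A (Y i w)) <=
  P [set w | exists n, forall i, (n <= i)%N -> ~ A (Y i w)].
Proof.
move=> t0 mA; set B := [set w | _].
have mB : measurable B by exact: measurable_eventually_miss.
have m0 w n : 0 <= mass_on t A (Y n w) by apply/mass_on_ge0/ltW.
apply: (@le_trans _ _ (\int[P]_w (\1_B w)%:E)); last first.
  by rewrite integral_indic ?setIT.
apply: ge0_le_integral => //.
- by move=> w _; exact: expeN_ge0.
- by apply: measurable_expeN_hits => //; exact: ltW.
- by apply/measurable_EFinP/measurable_indic.
move=> w _; rewrite indicE.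
have [Bw|nBw] := pselect (B w).
  by rewrite mem_set// expeN_le1// nneseries_ge0.
rewrite memNset//.
suff -> : \sum_(i <oo) mass_on t A (Y i w) = +oo by [].
apply/eqP; rewrite -leye_eq leNgt; apply/negP => sumfin.
apply: nBw.
have /(_ sumfin) := @nneseries_tail_cvg R (fun i => mass_on t A (Y i w)) xpredT.
move=> /(_ (fun k _ => m0 w k)) tail0.
have : \forall n \near \oo, \sum_(n <= k <oo) mass_on t A (Y k w) < t.
  have nb : nbhs (0%R : \bar R) [set x | x < t] by exact: open_ereal_lt'.
  exact: (tail0 _ nb).
move=> [n _ tailn]; exists n => i ni Ai.
have := tailn n (leqnn n); rewrite /= ltNge => /negP; apply.
apply: le_trans (@le_tail_nneseries (fun i => mass_on t A (Y i w)) n i _ ni) => //.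
by rewrite /mass_on indicE mem_set// mule1.
Qed.

End hitting.

Section hitting_poisson.
Local Open Scope ereal_scope.
Context d (T : measurableType d) (R : realType) (P : probability T R).

Lemma poisson_void d' (E : measurableType d') (X : nat -> T -> E)
    (mu : {measure set E -> \bar R}) (A : set E) :
  poisson_process P X mu -> measurable A ->
  P [set w | forall i, ~ A (X i w)] = expeN (mu A).
Proof.
move=> XP mA; have mX := poisson_process_measurable XP.
rewrite -(expectation_hit_oo P mX mA) (laplace_functional XP).
- congr expeN; under eq_integral do
    rewrite one_minus_expeN_mass_on {1}/expeN/= oppr0 adde0 mul1e.
  by rewrite integral_indic// setIT.
- exact: measurable_mass_on.
- by move=> x; exact: mass_on_ge0.
Qed.

End hitting_poisson.

(** * Poisson processes with independent marks *)

Section marked_poisson.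
Local Open Scope ereal_scope.
Context d (T : measurableType d) (R : realType) (P : probability T R).
Context d1 d2 (E1 : measurableType d1) (E2 : measurableType d2).
Variables (X : nat -> T -> E1) (G : nat -> T -> E2) (Q : probability E2 R).
Variable mu : {measure set E1 -> \bar R}.
Hypothesis XP : poisson_process P X mu.
Hypothesis mG : forall i, measurable_fun setT (G i).
Hypothesis G_law : forall i A, measurable A -> P (G i @^-1` A) = Q A.
Hypothesis G_indep : indep_of_seq P X G.
Let mX := poisson_process_measurable XP.
Let Y i w := (X i w, G i w).
Let mY i : measurable_fun setT (Y i).
Proof. exact: measurable_fun_pair. Qed.

Lemma cvg_expeN_partial (Z : nat -> T -> \bar R) :
  (forall i, measurable_fun setT (Z i)) -> (forall i w, 0 <= Z i w) ->
  \int[P]_w \prod_(i < n) expeN (Z i w) @[n --> \oo] -->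
  \int[P]_w expeN (\sum_(i <oo) Z i w).
Proof.
move=> mZ Z0.
rewrite (_ : (fun n => _) =
    fun n => \int[P]_w expeN (\sum_(0 <= i < n) Z i w)); last first.
  apply/funext => n; apply: eq_integral => w _.
  by rewrite expeN_sum// big_mkord.
apply: expectation_expeN_cvg.
- by move=> n; exact: emeasurable_sum.
- by apply: ge0_emeasurable_sum.
- by move=> n w; exact: sume_ge0.
- by move=> w; exact: nneseries_ge0.
- by move=> w; apply: is_cvg_nneseries.
Qed.

(** Averaging the marks of e^(- h) produces a function ghat of the points with
    values in [0, 1], and - ln ghat is again a nonnegative function, infinite
    where ghat vanishes; the unmarked functional applies to it. *)
Lemma marked_laplace (h : E1 * E2 -> \bar R) :
  measurable_fun setT h -> (forall z, 0 <= h z) ->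
  \int[P]_w expeN (\sum_(i <oo) h (Y i w)) =
  expeN (\int[mu]_x (1 - \int[Q]_c expeN (h (x, c)))).
Proof.
move=> mh h0; pose g z := expeN (h z).
have mg : measurable_fun setT g.
  by apply: measurableT_comp mh; exact: measurable_expeN.
have g0 z : 0 <= g z by exact: expeN_ge0.
pose ghat x := \int[Q]_c g (x, c).
have mghat : measurable_fun setT ghat.
  exact: measurable_fun_fubini_tonelli_F.
have ghat0 x : 0 <= ghat x by apply: integral_ge0 => c _.
have ghat1 x : ghat x <= 1.
  rewrite -(@probability_setT _ _ _ Q) -[leRHS]mul1e -integral_cst//.
  apply: ge0_le_integral => //; first exact: measurable_fun_pair2.
  by move=> c _; exact: expeN_le1.
pose k x := - lne (ghat x).
have mk : measurable_fun setT k.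
  apply: measurableT_comp => //; apply: measurableT_comp mghat.
  exact: measurable_lne.
have k0 x : 0 <= k x by rewrite /k oppe_ge0 lne_le0.
have expk x : expeN (k x) = ghat x.
  by rewrite /expeN /k oppeK lneK// in_itv/= ghat0 leey.
have := laplace_functional XP mk k0.
under [in RHS]eq_integral do rewrite expk.
move=> <-.
have cvg1 := cvg_expeN_partial (fun i => measurableT_comp mh (mY i))
  (fun i w => h0 (Y i w)).
have cvg2 := cvg_expeN_partial (fun i => measurableT_comp mk (mX i))
  (fun i w => k0 (X i w)).
rewrite -(cvg_lim _ cvg1)// -(cvg_lim _ cvg2)//.
apply: congr_lim; apply/funext => n.
have marks := @expectation_marks _ _ _ P _ _ _ _ X G Q mX mG G_law G_indep g n
  (cst 1) mg g0 (measurable_cst _) (fun=> lee01).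
transitivity (\int[P]_w (cst 1 w * \prod_(i < n) g (X i w, G i w))).
  by apply: eq_integral => w _; rewrite mul1e.
rewrite marks; apply: eq_integral => w _; rewrite mul1e.
by apply: eq_bigr => i _; rewrite expk.
Qed.

Lemma one_minus_expectation (f : E2 -> \bar R) : measurable_fun setT f ->
  (forall c, 0 <= f c <= 1) -> 1 - \int[Q]_c f c = \int[Q]_c (1 - f c).
Proof.
move=> mf f01.
have f0 c : 0 <= f c by case/andP : (f01 c).
have f1 c : f c <= 1 by case/andP : (f01 c).
have ffin c : f c \is a fin_num.
  by rewrite ge0_fin_numE// (le_lt_trans (f1 c))// ltry.
have int1 : \int[Q]_c f c + \int[Q]_c (1 - f c) = 1.
  rewrite -ge0_integralD//.
  - under eq_integral do rewrite addeC subeK//.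
    by rewrite integral_cst//= probability_setT mule1.
  - by move=> c _; rewrite sube_ge0// ffin.
  - exact: emeasurable_funB.
have If0 : 0 <= \int[Q]_c f c by exact: integral_ge0.
have Ig0 : 0 <= \int[Q]_c (1 - f c).
  by apply: integral_ge0 => c _; rewrite sube_ge0// ffin.
have If1 : \int[Q]_c f c <= 1.
  by apply: le_trans (leeDl _ Ig0) _; rewrite int1.
rewrite -[X in X - _]int1 addeAC subee ?add0e// ge0_fin_numE//.
by rewrite (le_lt_trans If1)// ltry.
Qed.

Lemma marked_hits t (A : set (E1 * E2)) : 0 <= t -> measurable A ->
  \int[P]_w expeN (\sum_(i <oo) mass_on t A (Y i w)) =
  expeN ((1 - expeN t) * \int[mu]_x Q (xsection A x)).
Proof.
move=> t0 mA; rewrite marked_laplace.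
- have m0 z : 0 <= mass_on t A z by exact: mass_on_ge0.
  have mm : measurable_fun setT (mass_on t A) by exact: measurable_mass_on.
  have t1 : 0 <= 1 - expeN t by rewrite sube_ge0 ?expeN_le1// expeN_fin_num.
  congr expeN; rewrite -ge0_integralZl//; last first.
    exact: measurable_fun_xsection.
  apply: eq_integral => x _; rewrite one_minus_expectation.
  + under eq_integral do rewrite one_minus_expeN_mass_on.
    rewrite ge0_integralZl//.
    * rewrite -[in RHS](setIT (xsection A x)).
      rewrite -integral_indic//; last exact: measurable_xsection.
      congr (_ * _); apply: eq_integral => c _.
      by rewrite !indicE mem_xsection.
    * have m1 : measurable_fun setT (fun z => (\1_A z)%:E : \bar R).
        exact/measurable_EFinP/measurable_indic.
      exact: (measurable_fun_pair2 x m1).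
  + apply: measurableT_comp; first exact: measurable_expeN.
    exact: (measurable_fun_pair2 x mm).
  + by move=> c; rewrite expeN_ge0 expeN_le1.
- exact: measurable_mass_on.
- by move=> z; exact: mass_on_ge0.
Qed.

Lemma marked_void (A : set (E1 * E2)) : measurable A ->
  P [set w | forall i, ~ A (X i w, G i w)] =
  expeN (\int[mu]_x Q (xsection A x)).
Proof.
move=> mA; rewrite -(expectation_hit_oo P mY mA) marked_hits//.
by rewrite {1}/expeN/= oppr0 adde0 mul1e.
Qed.

(** The number N of points in A satisfies P(N < oo) >= E e^(- t N)
    = exp (- (1 - e^(- t)) m) for every t > 0, where m is the intensity of A.
    Letting t decrease to 0 gives probability one. *)
Lemma marked_eventually_miss (A : set (E1 * E2)) : measurable A ->
  \int[mu]_x Q (xsection A x) < +oo ->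
  P [set w | exists n, forall i, (n <= i)%N -> ~ A (X i w, G i w)] = 1.
Proof.
move=> mA mAfin; set B := [set w | _].
have mB : measurable B by exact: (measurable_eventually_miss mY mA).
apply/eqP; rewrite eq_le probability_le1//=.
have [m m0 mE] : exists2 m, (0 <= m)%R & \int[mu]_x Q (xsection A x) = m%:E.
  have I0 : 0 <= \int[mu]_x Q (xsection A x) by exact: integral_ge0.
  by exists (fine (\int[mu]_x Q (xsection A x)));
    rewrite ?fine_ge0// fineK// ge0_fin_numE.
have bound (t : R) : (0 < t)%R -> 1 - (t * m)%:E <= P B.
  move=> t0; have := @expectation_hit_le _ _ _ P _ _ Y mY t%:E A t0 mA.
  apply: le_trans; rewrite marked_hits//; last by rewrite lee_fin ltW.
  rewrite mE /expeN/= lee_fin.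
  apply: le_trans (expR_ge1Dx _); rewrite lerD2l lerN2 ler_wpM2r//.
  by have := expR_ge1Dx (- t); lra.
rewrite leNgt; apply/negP => PB1.
have PBfin : P B \is a fin_num by exact: fin_num_measure.
have [p pE] : exists p, P B = p%:E by exists (fine (P B)); rewrite fineK.
move: PB1; rewrite pE lte_fin => p1.
(* small enough for t m to be below the gap 1 - p *)
pose t := ((1 - p) / (2 * (m + 1)))%R.
have t0 : (0 < t)%R.
  by rewrite divr_gt0 ?subr_gt0// mulr_gt0// ltr_wpDl.
have := bound t t0; rewrite pE -EFinB lee_fin => tm.
have m1 : (0 < m + 1)%R by rewrite ltr_wpDl.
have : (t * (m + 1) = (1 - p) / 2)%R.
  by rewrite /t; field; rewrite gt_eqF.
have := t0; nra.
Qed.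

End marked_poisson.

(** * Random fields and their suprema *)

Section evaluation.
Context {R : realType} {d : nat}.
Implicit Types x : 'rV[R]_d.

(** The grid cell of mesh 1 / (n + 1) containing x. Rounding x to a grid point
    takes countably many values, so that evaluating a random continuous
    function at a rounded random site is measurable cell by cell. *)
Definition grid_index (n : nat) x : 'rV[int]_d :=
  \row_j Num.floor (x ord0 j * n.+1%:R).

Definition grid_point (n : nat) (k : 'rV[int]_d) : 'rV[R]_d :=
  \row_j ((k ord0 j)%:~R / n.+1%:R).

Lemma grid_point_cvg x : grid_point n (grid_index n x) @[n --> \oo] --> x.
Proof.
move=> A [B nB BA].
have near_all : \forall n \near \oo, forall ij : 'I_1 * 'I_d,
    B ij.1 ij.2 (grid_point n (grid_index n x) ij.1 ij.2).
  apply: filter_forall => -[i j] /=.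
  have xij : (fun n : nat => grid_point n (grid_index n x) i j) @ \oo --> x i j.
    rewrite ord1; apply/cvgrPdist_lt => e e0; near=> n.
    rewrite !mxE distrC.
    have n0 : (0 : R) < n.+1%:R by [].
    set z := x ord0 j * n.+1%:R.
    rewrite -[x ord0 j](mulfK (lt0r_neq0 n0)) -/z -mulrBl normrM.
    rewrite [X in _ * X]gtr0_norm ?invr_gt0// ltr_pdivrMr//.
    apply: (@lt_trans _ _ 1).
      have /andP[fl1 fl2] := floor_itv z.
      rewrite ler0_norm ?subr_le0//; last by rewrite opprB ltrBlDr addrC -intrD1.
    rewrite -ltr_pdivrMr// div1r; near: n.
    exact: (near_infty_natSinv_lt (PosNum e0)).
  exact: xij.
apply: filterS near_all => n nBn; apply: BA => i j; exact: (nBn (i, j)).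
Unshelve. all: by end_near. Qed.

(** A continuous function at a random site is the limit of its values at the
    rounded sites. The sigma-algebra on continuous functions only makes
    evaluations at fixed sites measurable. *)
Lemma measurable_evaluation d' (T : measurableType d') (f : T -> C_Rd R d)
    (a : T -> 'rV[R]_d) :
  measurable_fun setT f -> measurable_fun setT a ->
  measurable_fun setT (fun w => f w (a w)).
Proof.
move=> mf ma.
have mfp x : measurable_fun setT (fun w => f w x).
  have mx : measurable_fun setT (fun g : C_Rd R d => g x).
    by move=> _ Y mY; apply: sub_sigma_algebra; exists x => //; exists Y.
  exact: (measurableT_comp mx mf).
apply: (measurable_fun_cvg
  (h := fun n w => f w (grid_point n (grid_index n (a w))))) => //.
- move=> n _ Y mY; rewrite setTI.
  rewrite (_ : _ @^-1` Y = \bigcup_(k : 'rV[int]_d)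
      ((fun w => grid_index n (a w)) @^-1` [set k] `&`
       (fun w => f w (grid_point n k)) @^-1` Y)); last first.
    apply/seteqP; split => [w Yw|w [k _ [/= <-]]//].
    by exists (grid_index n (a w)).
  apply: countable_bigcupT_measurable => [|k].
    exact: countableP.
  apply: measurableI; last first.
    by rewrite -[X in measurable X]setTI; exact: mfp.
  rewrite (_ : _ @^-1` _ = \big[setI/setT]_(j < d)
      ((fun w => a w ord0 j * n.+1%:R) @^-1`
        [set` `[(k ord0 j)%:~R, (k ord0 j + 1)%:~R[ ])); last first.
    rewrite -bigcap_seq; apply/seteqP; split => [w /= <- j _|w /= kw].
      by rewrite /= in_itv/= mxE floor_itv.
    apply/rowP => j; rewrite mxE; apply/eqP; rewrite floor_eq.
    by have := kw j (mem_index_enum _); rewrite /= in_itv.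
  apply: bigsetI_measurable => j _; rewrite -[X in measurable X]setTI.
  have : measurable_fun setT (fun w => a w ord0 j * n.+1%:R).
    apply: measurable_funM => //.
    exact: (measurableT_comp (measurable_coord j) ma).
  by apply; [exact: measurableT|exact: measurable_itv].
- move=> w _.
  have cf := @cts_fun _ _ (f w) (a w).
  exact: (cvg_comp _ _ (@grid_point_cvg (a w)) cf).
Qed.

End evaluation.

Section suprema.
Local Open Scope ereal_scope.
Context {R : realType}.

Lemma ereal_sup_le_all (V : nat -> R) (y : R) :
  (ereal_sup (range (fun i => (V i)%:E)) <= y%:E) <-> forall i, (V i <= y)%R.
Proof.
split=> [supy i|Vy].
  rewrite -lee_fin; apply: le_trans supy; apply: ereal_sup_ubound.
  by exists i.
by apply: ge_ereal_sup => _ [i _ <-]; rewrite lee_fin.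
Qed.

(** Past the level y there is at least one value and only finitely many of them,
    so the largest of the first n values is the supremum. *)
Lemma ereal_sup_attained (V : nat -> R) (y : R) (n : nat) i0 :
  (y < V i0)%R -> (forall i, (n <= i)%N -> ~ (y < V i)%R) ->
  exists i, ereal_sup (range (fun i => (V i)%:E)) = (V i)%:E.
Proof.
move=> yV0 tail.
have ni0 : (i0 < n)%N by rewrite ltnNge; apply/negP => /tail; exact.
pose k := [arg max_(i > Ordinal ni0) V i]%O.
have kmax (i : 'I_n) : (V i <= V k)%R.
  by rewrite /k; case: arg_maxP => // m _ max; exact: max.
exists k; apply/eqP; rewrite eq_le; apply/andP; split; last first.
  by apply: ereal_sup_ubound; exists (k : nat).
apply/ereal_sup_le_all => i; have [ni|ni] := leqP n i.
  have /negP := tail i ni; rewrite -leNgt => /le_trans; apply.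
  by apply: (le_trans (ltW yV0)); exact: (kmax (Ordinal ni0)).
exact: (kmax (Ordinal ni)).
Qed.

Context d (T : measurableType d) (U : Type) (V : nat -> U -> T -> R).
Hypothesis mV : forall i t, measurable_fun setT (V i t).

Lemma measurable_sup_family t :
  measurable_fun setT (fun w => ereal_sup (range (fun i => (V i t w)%:E))).
Proof.
have := @measurable_fun_esups _ _ R setT (fun i w => (V i t w)%:E)
  (fun i => (measurable_EFinP setT (V i t)).2 (mV i t)) 0.
apply: eq_measurable_fun => w _; rewrite /esups/= /sdrop.
by congr ereal_sup; apply/seteqP; split=> _ [i _ <-]; exists i.
Qed.

End suprema.

Section fdd.
Local Open Scope ereal_scope.
Context {R : realType} (U : eqType).
Context da db (Ta : measurableType da) (Tb : measurableType db).
Variables (Pa : probability Ta R) (Pb : probability Tb R).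
Variables (Za : U -> Ta -> \bar R) (Zb : U -> Tb -> \bar R).
Hypothesis mZa : forall t, measurable_fun setT (Za t).
Hypothesis mZb : forall t, measurable_fun setT (Zb t).
Hypothesis cdf_eq : forall s : seq (U * R),
  Pa [set w | forall p, p \in s -> Za p.1 w <= p.2%:E] =
  Pb [set w | forall p, p \in s -> Zb p.1 w <= p.2%:E].

(** Joint distribution functions determine the law of a tuple. With a sequence of
    pairs (site, threshold), rather than one threshold per site, the events form
    a pi-system by concatenation, and a single coordinate can be bounded while
    the others are left free, possibly infinite. *)
Lemma equal_fdd_cdf : equal_fdd Pa Pb Za Zb.
Proof.
move=> n t B mB.
have mtup (dT : measure_display) (T : measurableType dT) (Z : U -> T -> \bar R) :
    (forall t, measurable_fun setT (Z t)) ->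
    measurable_fun setT (fun w => [tuple Z (tnth t i) w | i < n]).
  move=> mZ; apply/measurable_fun_tnthP => i.
  rewrite (_ : _ \o _ = Z (tnth t i))//.
  by apply/funext => w /=; rewrite tnth_mktuple.
pose Xa : {RV Pa >-> n.-tuple (\bar R)} := mfun_Sub (mem_set (mtup _ _ _ mZa)).
pose Xb : {RV Pb >-> n.-tuple (\bar R)} := mfun_Sub (mem_set (mtup _ _ _ mZb)).
pose box (s : seq ('I_n * R)) :=
  [set x : n.-tuple (\bar R) | forall p, p \in s -> tnth x p.1 <= p.2%:E].
pose G := range box.
have mle i r : measurable [set x : n.-tuple (\bar R) | tnth x i <= r%:E].
  rewrite -[X in measurable X]setTI.
  by apply: emeasurable_fun_infty_c => //; exact: measurable_tnth.
have box_cons p s :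
    box (p :: s) = [set x | tnth x p.1 <= p.2%:E] `&` box s.
  apply/seteqP; split => [x xs|x [xp xs] q].
    by split => [|q qs]; apply: xs; rewrite in_cons ?eqxx// qs orbT.
  by rewrite in_cons => /orP[/eqP ->//|]; exact: xs.
have mbox s : measurable (box s).
  elim: s => [|p s ih]; last by rewrite box_cons; exact: measurableI.
  rewrite (_ : box [::] = setT)//.
  by apply/seteqP; split.
suff : distribution Pa Xa B = distribution Pb Xb B by [].
apply: (measure_unique G (fun=> setT)) => //.
- rewrite eqEsubset; split.
    apply: smallest_sub; first exact: smallest_sigma_algebra.
    have mcoord i : measurable_fun setT
        (fun x : g_sigma_algebraType G => tnth (x : n.-tuple (\bar R)) i).
      apply: (measurability _ (ErealGenOInfty.measurableE R)).
      move=> _ [_ [r ->] <-]; rewrite setTI.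
      have mG : measurable (box [:: (i, r)] : set (g_sigma_algebraType G)).
        by apply: sub_sigma_algebra; exists [:: (i, r)].
      rewrite (_ : _ @^-1` _ = ~` (box [:: (i, r)])); first exact: measurableC.
      apply/seteqP; split => [x /=|x].
        rewrite in_itv/= andbT ltNge => /negP xr xle; apply: xr.
        by apply: (xle (i, r)); rewrite mem_head.
      move=> /= nxr; rewrite in_itv/= andbT ltNge; apply/negP => xr.
      by apply: nxr => p; rewrite inE => /eqP ->.
    move=> A; rewrite -bigcup_seq => -[i _ [C mC <-]].
    exact: mcoord.
  apply: smallest_sub; first exact: sigma_algebra_measurable.
  by move=> _ [s _ <-]; exact: mbox.
- move=> _ _ [s1 _ <-] [s2 _ <-]; exists (s1 ++ s2) => //.
  apply/seteqP; split => [x xs|x [xs1 xs2] p].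
    by split => p ps; apply: xs; rewrite mem_cat ps ?orbT.
  by rewrite mem_cat => /orP[]; [exact: xs1|exact: xs2].
- by move=> _; exists [::] => //; apply/seteqP; split.
- by rewrite bigcup_const.
- move=> _ [s _ <-].
  have boxE (dT : measure_display) (T : measurableType dT)
      (Z : U -> T -> \bar R) :
      [set w | box s [tuple Z (tnth t i) w | i < n]] =
      [set w | forall p, p \in [seq (tnth t p.1, p.2) | p <- s] ->
        Z p.1 w <= p.2%:E].
    apply/seteqP; split => w /= sw p.
      by move=> /mapP[q /sw + ->] /=; rewrite tnth_mktuple.
    move=> ps; rewrite tnth_mktuple.
    by apply: (sw (tnth t p.1, p.2)); apply/mapP; exists p.
  transitivity (Pa [set w | box s [tuple Za (tnth t i) w | i < n]]) => //.
  transitivity (Pb [set w | box s [tuple Zb (tnth t i) w | i < n]]) => //.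
  by rewrite !boxE.
- by move=> _; rewrite (le_lt_trans (probability_le1 _ _)) ?ltry.
Qed.

End fdd.

(** * Exponential moments *)

Section exponential_moment.
Local Open Scope ereal_scope.
Context {R : realType}.
Import HBNNSimple.

Lemma integral_density d (T : measurableType d)
    (mu nu : {measure set T -> \bar R}) (p : T -> R) (f : T -> \bar R) :
  measurable_fun setT p -> (forall x, 0 <= p x)%R ->
  (forall A, measurable A -> nu A = \int[mu]_(x in A) (p x)%:E) ->
  measurable_fun setT f -> (forall x, 0 <= f x) ->
  \int[nu]_x f x = \int[mu]_x (f x * (p x)%:E).
Proof.
move=> mp p0 nuE mf f0; pose fn := nnsfun_approx measurableT mf.
have mfn n : measurable_fun setT (fun x => (fn n x)%:E).
  exact/measurable_EFinP.
have cvg_fn x : (fn n x)%:E @[n --> \oo] --> f x.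
  by apply: cvg_nnsfun_approx => // y _; exact: f0.
have mpE : measurable_fun setT (EFin \o p) by exact/measurable_EFinP.
have nd_fn x : {homo (fun n => (fn n x)%:E) : m n / (m <= n)%N >-> m <= n}.
  by move=> m n mn; rewrite lee_fin; exact/lefP/nd_nnsfun_approx.
have cvg1 : \int[nu]_x (fn n x)%:E @[n --> \oo] --> \int[nu]_x f x.
  rewrite (_ : (fun x => f x) = fun x => limn (fun n => (fn n x)%:E)).
    by apply: cvg_monotone_convergence => // n x _; rewrite lee_fin.
  by apply/funext => x; apply/esym/cvg_lim.
have cvg2 : \int[mu]_x ((fn n x)%:E * (p x)%:E) @[n --> \oo] -->
    \int[mu]_x (f x * (p x)%:E).
  rewrite (_ : (fun x => f x * _) =
      fun x => limn (fun n => (fn n x)%:E * (p x)%:E)).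
    apply: cvg_monotone_convergence => //.
    - by move=> n; exact: emeasurable_funM.
    - by move=> n x _; rewrite mule_ge0// lee_fin.
    - by move=> x _ m n mn; rewrite lee_wpmul2r ?lee_fin//; exact: nd_fn.
  apply/funext => x; apply/esym/cvg_lim => //.
  by apply: cvgeZr => //; exact: cvg_fn.
rewrite -(cvg_lim _ cvg1)// -(cvg_lim _ cvg2)//.
apply: congr_lim; apply/funext => n.
have fnE x : (fn n x)%:E = `|fn n x|%:E by rewrite ger0_norm.
under eq_integral do rewrite fnE.
rewrite (integral_comp_nnsfun _ _ (@normr_ge0 _ _)).
transitivity (\int[mu]_x \sum_(y <- fset_set (range (fn n)))
    (`|y|%:E * ((\1_(fn n @^-1` [set y]) x)%:E * (p x)%:E))).
  rewrite ge0_integral_sum//.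
  - apply: eq_bigr => y _; rewrite ge0_integralZl//.
    + congr (_ * _); rewrite nuE// integral_mkcond; apply: eq_integral => x _.
      rewrite patchE indicE; case: ifPn => _; first by rewrite mul1e.
      by rewrite mul0e.
    + by apply: emeasurable_funM => //; apply/measurable_EFinP/measurable_indic.
    + by move=> x _; rewrite mule_ge0// lee_fin.
  - move=> y; apply/measurable_funeM/emeasurable_funM => //.
    exact/measurable_EFinP/measurable_indic.
  - by move=> y x _; rewrite !mule_ge0// lee_fin.
apply: eq_integral => x _.
rewrite (bigD1_seq (fn n x))/=; last 2 first.
- by rewrite in_fset_set// inE; exists x.
- exact: fset_uniq.
rewrite indicE mem_set// mul1e big1 ?adde0.
  by rewrite ger0_norm.
move=> y yhx; rewrite indicE memNset ?mul0e ?mule0//= => /esym hxy.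
by move: yhx; rewrite hxy eqxx.
Qed.

(** Completing the square: weighting a Gaussian density by the exponential
    shifts its mean by the variance. *)
Lemma expR_normal_pdf (m s x : R) : s != 0%R ->
  (expR x * normal_pdf m s x =
   expR (m + s ^+ 2 / 2) * normal_pdf (m + s ^+ 2) s x)%R.
Proof.
move=> s0; rewrite !normal_pdfE// /normal_fun mulrCA [RHS]mulrCA.
congr (_ * _)%R; rewrite -!expRD; congr expR.
by rewrite -mulr_natr; field; rewrite s0.
Qed.

(** Only finiteness matters; in the nondegenerate case the value is
    exp (m + s^2 / 2). *)
Lemma gaussian_exp_moment d (T : measurableType d) (P : probability T R)
    (X : T -> R) : measurable_fun setT X -> gaussian_rv P X ->
  \int[P]_w (expR (X w))%:E < +oo.
Proof.
move=> mX [m [s lawX]].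
have mX' : @measurable_fun _ _ T (measurableTypeR R) setT X by [].
pose XT : {RV P >-> measurableTypeR R} :=
  @mfun_Sub _ _ T (measurableTypeR R) X (mem_set mX').
have mexp : measurable_fun setT (fun x : R => (expR x)%:E).
  by apply/measurable_EFinP; exact: measurable_expR.
have -> : \int[P]_w (expR (X w))%:E = \int[distribution P XT]_x (expR x)%:E.
  by rewrite ge0_integral_distribution// => x; rewrite lee_fin expR_ge0.
have [s0|s0] := eqVneq s 0%R.
  have -> : \int[distribution P XT]_x (expR x)%:E =
      \int[\d_(m : measurableTypeR R)]_x (expR x)%:E.
    apply: eq_measure_integral => A mA _.
    by have := lawX A mA; rewrite s0 eqxx.
  by rewrite integral_dirac// diracT mul1e ltry.
have -> : \int[distribution P XT]_x (expR x)%:E =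
    \int[lebesgue_measure]_x ((expR x)%:E * (normal_pdf m s x)%:E).
  apply: integral_density => //.
  - exact: measurable_normal_pdf.
  - by move=> x; exact: normal_pdf_ge0.
  - by move=> A mA; have := lawX A mA; rewrite (negbTE s0).
under [X in X < _]eq_integral do rewrite -EFinM expR_normal_pdf// EFinM.
rewrite ge0_integralZl//.
- by rewrite integral_normal_pdf mule1 ltry.
- by apply/measurable_EFinP; exact: measurable_normal_pdf.
- by move=> x _; rewrite lee_fin normal_pdf_ge0.
Qed.

Lemma exp_moment_gt0 d (T : measurableType d) (P : probability T R)
    (X : T -> R) : measurable_fun setT X -> 0 < \int[P]_w (expR (X w))%:E.
Proof.
move=> mX; rewrite lt0e integral_ge0 ?andbT; last first.
  by move=> w _; rewrite lee_fin expR_ge0.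
apply/eqP => mom_eq0.
have mexp : measurable_fun setT (fun w => (expR (X w))%:E).
  exact/measurable_EFinP/(measurableT_comp (@measurable_expR R)).
have abs0 : \int[P]_w `|(expR (X w))%:E| = 0.
  by under eq_integral do rewrite gee0_abs ?lee_fin ?expR_ge0//.
have /(ae_eq_integral_abs P measurableT mexp) ae0 := abs0.
have nT : P.-negligible setT.
  by apply: negligibleS ae0 => w _ /= /(_ Logic.I)[] /eqP; rewrite expR_eq0.
have PT0 : P setT = 0 := measure_negligible measurableT nT.
have PT1 : P setT = 1 := probability_setT P.
by move: PT1; rewrite PT0 => /esym/eqP; rewrite onee_eq0.
Qed.

Lemma expN_measure_ray (r : R) :
  expN_measure [set x : R | (r < x)%R] = (expR (- r))%:E.
Proof.
rewrite /expN_measure (_ : [set _ | _] = `]r, +oo[%classic); last first.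
  by apply/seteqP; split => x /=; rewrite in_itv/= andbT.
rewrite integral_itv_obnd_cbnd; last first.
  apply/measurable_EFinP; apply: measurable_funTS.
  by apply: measurableT_comp => //; exact: measurable_expR.
have cN : continuous (fun z : R => expR (- z)).
  move=> x; apply: continuous_comp; first exact: opp_continuous.
  exact: continuous_expR.
rewrite (@ge0_continuous_FTC2y _ _ (fun x => - expR (- x))%R _ 0%R)//.
- by rewrite add0e -EFinN opprK.
- exact: continuous_subspaceT.
- by rewrite -oppr0; apply: cvgN; exact: cvgr_expR.
- by apply: cvgN; apply/cvg_at_right_filter; exact: cN.
- move=> x _; rewrite derive1_comp// derive1N// derive1_id mulN1r.
  rewrite derive1_comp// derive1E; have /funeqP -> := @derive_expR R.
  by rewrite derive1N// derive1_id mulrN1 opprK.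
Qed.

End exponential_moment.

(** * Void probabilities of Brown-Resnick systems *)

Section almost_sure.
Local Open Scope ereal_scope.
Context d (T : measurableType d) (R : realType) (P : probability T R).

Lemma ae_iff_probability (A B : set T) : measurable A -> measurable B ->
  (\forall w \ae P, A w <-> B w) -> P A = P B.
Proof.
move=> mA mB AB.
rewrite -[A]setIT -[B]setIT -!(integral_indic P measurableT)//.
apply: ge0_ae_eq_integral => //.
- exact/measurable_EFinP/measurable_indic.
- exact/measurable_EFinP/measurable_indic.
apply: filterS AB => w [AB BA] _; rewrite !indicE; congr (_%:R%:E).
by congr nat_of_bool; apply/idP/idP; rewrite !inE.
Qed.

Lemma probability1_ae (A : set T) : measurable A -> P A = 1 ->
  \forall w \ae P, A w.
Proof.
move=> mA PA; exists (~` A); split => //; first exact: measurableC.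
by have := probability_setC P mA; rewrite PA subee.
Qed.

End almost_sure.

Section exceedances.
Context {R : realType} (U : eqType).
Context d (T : measurableType d) (V : U -> T -> R).

Definition exceeds (s : seq (U * R)) : set T :=
  [set z | exists2 p, p \in s & p.2 < V p.1 z].

Lemma measurable_exceeds s : (forall t, measurable_fun setT (V t)) ->
  measurable (exceeds s).
Proof.
move=> mV; rewrite (_ : exceeds s =
    \bigcup_(p in [set` s]) [set z | p.2 < V p.1 z]); last first.
  by apply/seteqP; split => z [p ps pz]; exists p.
apply: fin_bigcup_measurable; first exact: finite_seq.
move=> p _; have := mV p.1 measurableT `]p.2, +oo[%classic (measurable_itv _).
rewrite setTI; congr measurable; apply/seteqP; split => z /=.
  by rewrite in_itv/= andbT.
by rewrite in_itv/= andbT.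
Qed.

(** The sup stays below all thresholds when no point exceeds any of them.
    This is what turns distribution functions into void probabilities. *)
Lemma sup_le_thresholds (Y : nat -> T) (s : seq (U * R)) :
  (forall p, p \in s ->
    (ereal_sup (range (fun i => (V p.1 (Y i))%:E)) <= p.2%:E)%E) <->
  (forall i, ~ exceeds s (Y i)).
Proof.
split=> [supY i [p ps]|YV p ps].
  by have /ereal_sup_le_all/(_ i) := supY p ps; rewrite leNgt => /negP.
apply/ereal_sup_le_all => i; rewrite leNgt; apply/negP => pV.
by apply: (YV i); exists p.
Qed.

End exceedances.

Section Brown_Resnick.
Local Open Scope ereal_scope.
Context (R : realType) (d : nat).
Local Notation field := (C_Rd R d).
Variable drift : 'rV[R]_d -> R.

Lemma measurable_eval_at (t : 'rV[R]_d) :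
  measurable_fun setT (fun f : field => f t).
Proof. by move=> _ Y mY; apply: sub_sigma_algebra; exists t => //; exists Y. Qed.

(** The contribution at site t of a point z = (x, f) of the process defining Z. *)
Definition spectral_value (t : 'rV[R]_d) (z : R * field) : R :=
  (z.1 + (z.2 t - drift t))%R.

(** The contribution at site t of a point z = ((s, u), f) of a mixed moving
    maxima process, whose shape f is centred at s. *)
Definition shifted_value (t : 'rV[R]_d) (z : ('rV[R]_d * R) * field) : R :=
  (z.1.2 + z.2 (t - z.1.1)%R)%R.

Lemma measurable_spectral_value t : measurable_fun setT (spectral_value t).
Proof.
apply: measurable_funD => //; apply: measurable_funB => //.
exact: (measurableT_comp (measurable_eval_at t) measurable_snd).
Qed.

Lemma measurable_shifted_value t : measurable_fun setT (shifted_value t).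
Proof.
apply: measurable_funD.
  exact: (measurableT_comp measurable_snd measurable_fst).
apply: measurable_evaluation => //; apply: measurable_fun_rV => i.
under eq_fun do rewrite !mxE.
apply: measurable_funB => //.
exact: (measurableT_comp (measurable_coord i)
  (measurableT_comp measurable_fst measurable_fst)).
Qed.

Context d0 d1 (T0 : measurableType d0) (T1 : measurableType d1).
Variables (P0 : probability T0 R) (W : {RV P0 >-> field}).
Variables (P1 : probability T1 R) (W1 : nat -> {RV P1 >-> field}).
Variables (X1 : nat -> T1 -> R) (sys1 : BR_system W W1 X1).

(** The intensity, under e^(- x) dx times the law of W, of the points that exceed
    one of the thresholds. It is common to all Brown-Resnick systems made of
    copies of W. *)
Definition BR_exponent (s : seq ('rV[R]_d * R)) : \bar R :=
  \int[@expN_measure R]_x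
    distribution P0 W (xsection (exceeds spectral_value s) x).

Lemma BR_void s :
  P1 [set w | forall i, ~ exceeds spectral_value s (X1 i w, W1 i w)] =
  expeN (BR_exponent s).
Proof.
case: sys1 => lawW PX indW.
apply: (marked_void PX (G := fun i => W1 i)) => //.
apply: measurable_exceeds; exact: measurable_spectral_value.
Qed.

Lemma measurable_BR_point i : measurable_fun setT (fun w => (X1 i w, W1 i w)).
Proof.
case: sys1 => _ PX _; apply: measurable_fun_pair => //.
exact: (poisson_process_measurable PX).
Qed.

(** By Tonelli, integrating the heights first: those above y + drift t - f t have
    mass e^(f t - drift t - y). *)
Lemma BR_exponent1 t y : BR_exponent [:: (t, y)] =
  (expR (- y - drift t))%:E * \int[P0]_w (expR (W w t))%:E.
Proof.
pose A := exceeds spectral_value [:: (t, y)].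
have mA : measurable A.
  by apply: measurable_exceeds; exact: measurable_spectral_value.
transitivity (\int[distribution P0 W]_f @expN_measure R (ysection A f)).
  have := @indic_fubini_tonelli _ _ _ _ R (@expN_measure R)
    (distribution P0 W) A mA.
  by rewrite (indic_fubini_tonelli_FE _ mA) (indic_fubini_tonelli_GE _ mA).
rewrite ge0_integral_distribution//; last exact: measurable_fun_ysection.
rewrite -ge0_integralZl//; last first.
- apply/measurable_EFinP; apply: measurableT_comp; first exact: measurable_expR.
  exact: (measurableT_comp (measurable_eval_at t)).
apply: eq_integral => w _ /=.
rewrite (_ : ysection A (W w) = [set x | (y + drift t - W w t < x)%R]).
  by rewrite expN_measure_ray -EFinM -expRD; congr (expR _)%:E; ring.
apply/seteqP; split => x; rewrite /ysection/= inE.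
  move=> [p]; rewrite inE => /eqP -> /=; rewrite /spectral_value/=.
  by move=> h; lra.
by move=> h; exists (t, y); rewrite ?mem_head// /spectral_value/=; lra.
Qed.

End Brown_Resnick.

(** * Void probabilities of mixed moving maxima *)

Section mixed_moving_maxima.
Local Open Scope ereal_scope.
Context (R : realType) (d : nat).
Local Notation field := (C_Rd R d).
Variables (lambda : R) (Q : probability field R).
Hypothesis lambda_gt0 : (0 < lambda)%R.

Let lambda_ge0 : (0 <= lambda)%R := ltW lambda_gt0.
Let heights := lebesgue_rV R d \x @expN_measure R.

(** The intensity, under lambda ds times e^(- u) du times Q, of the points of a
    mixed moving maxima process that exceed one of the thresholds. *)
Definition M3_exponent (s : seq ('rV[R]_d * R)) : \bar R :=
  lambda%:E * (heights \x Q) (exceeds (@shifted_value R d) s).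

Lemma measurable_exceeds_shifted s :
  measurable (exceeds (@shifted_value R d) s).
Proof. by apply: measurable_exceeds; exact: measurable_shifted_value. Qed.

Lemma measurable_exceeds_spectral (drift : 'rV[R]_d -> R) s :
  measurable (exceeds (spectral_value drift) s).
Proof. by apply: measurable_exceeds; exact: measurable_spectral_value. Qed.

(** Recentring a path at a site Tm and subtracting its level M, which is added
    back to the height, leaves the contribution of the point unchanged, so
    almost surely both descriptions of the process miss the exceedance set
    simultaneously. The two void probabilities coincide, and they determine the
    exponents. *)
Lemma M3_exponentE (drift : 'rV[R]_d -> R)
    d0 d1 (T0 : measurableType d0) (T1 : measurableType d1)
    (P0 : probability T0 R) (W : {RV P0 >-> field})
    (P1 : probability T1 R) (W1 : nat -> {RV P1 >-> field})
    (X1 : nat -> T1 -> R) (sys1 : BR_system W W1 X1)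
    (Tm : nat -> T1 -> 'rV[R]_d) (M : nat -> T1 -> R) (F : nat -> T1 -> field)
    (FP : forall i, \forall w \ae P1, forall t,
       F i w t = (W1 i w (t + Tm i w) - drift (t + Tm i w) - M i w)%R)
    (lambdaQ : poisson_process P1
       (fun i w => (Tm i w, X1 i w + M i w, F i w)%R)
       (fun A => lambda%:E * (heights \x Q) A)) s :
  M3_exponent s = BR_exponent drift W s.
Proof.
apply: (@expeN_inj R).
have mA := measurable_exceeds_shifted s.
have mB := measurable_exceeds_spectral drift s.
have <- := BR_void drift sys1 s.
pose mu := mscale (NngNum lambda_ge0) (heights \x Q).
have lambdaQ' : poisson_process P1
  (fun i w => (Tm i w, X1 i w + M i w, F i w)%R) mu := lambdaQ.
transitivity (P1 [set w | forall i, ~ exceeds (@shifted_value R d) s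
    (Tm i w, X1 i w + M i w, F i w)%R]).
  exact/esym/(poisson_void lambdaQ' mA).
apply: ae_iff_probability.
- exact: (measurable_miss (poisson_process_measurable lambdaQ') mA).
- exact: (measurable_miss (measurable_BR_point sys1) mB).
apply: filterS (ae_foralln FP) => w Fw /=.
have same i t : shifted_value t (Tm i w, X1 i w + M i w, F i w)%R =
    spectral_value drift t (X1 i w, W1 i w).
  by rewrite /shifted_value/spectral_value/= Fw subrK; ring.
by split=> miss i [p ps pV]; apply: (miss i); exists p => //; rewrite ?same// -same.
Qed.

Context d2 (T2 : measurableType d2) (P2 : probability T2 R).
Variables (S : nat -> T2 -> 'rV[R]_d) (U : nat -> T2 -> R).
Variable G : nat -> {RV P2 >-> field}.
Hypothesis PiP : poisson_process P2 (fun i w => (S i w, U i w))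
  (fun A => lambda%:E * heights A).
Hypothesis G_law :
  forall i A, measurable A -> distribution P2 (G i) A = Q A.
Hypothesis G_indep : indep_of_seq P2 (fun i w => (S i w, U i w)) G.

Let mu := mscale (NngNum lambda_ge0) heights.

Let PiP' : poisson_process P2 (fun i w => (S i w, U i w)) mu := PiP.

Lemma M3_section_integral s :
  \int[mu]_x Q (xsection (exceeds (@shifted_value R d) s) x) = M3_exponent s.
Proof.
rewrite ge0_integral_mscale//; apply: measurable_fun_xsection.
exact: measurable_exceeds_shifted.
Qed.

Lemma measurable_M3_point i :
  measurable_fun setT (fun w => ((S i w, U i w), G i w)).
Proof.
by apply: measurable_fun_pair => //; exact: (poisson_process_measurable PiP').
Qed.

Lemma M3_void s :
  P2 [set w | forall i,
    ~ exceeds (@shifted_value R d) s ((S i w, U i w), G i w)] =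
  expeN (M3_exponent s).
Proof.
rewrite -M3_section_integral.
apply: (marked_void PiP' (G := fun i => G i) (Q := Q)) => //.
exact: measurable_exceeds_shifted.
Qed.

Lemma M3_eventually_miss s : M3_exponent s < +oo ->
  \forall w \ae P2, exists n, forall i, (n <= i)%N ->
    ~ exceeds (@shifted_value R d) s ((S i w, U i w), G i w).
Proof.
move=> fin; apply: probability1_ae.
  exact: (measurable_eventually_miss measurable_M3_point
    (measurable_exceeds_shifted s)).
apply: (marked_eventually_miss PiP' (G := fun i => G i) (Q := Q)) => //.
- exact: measurable_exceeds_shifted.
- by rewrite M3_section_integral.
Qed.

(** The exponent at level - n is finite, so only finitely many points lie above
    it; it grows like e^n, so the probability that no point lies above level
    - n, for every n, is zero. *)
Lemma M3_attained (t : 'rV[R]_d) (K : R) : (0 < K)%R ->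
  (forall y, M3_exponent [:: (t, y)] = (expR (- y) * K)%:E) ->
  \forall w \ae P2, exists i,
    ereal_sup (range (fun j => (U j w + G j w (t - S j w))%R%:E)) =
    (U i w + G i w (t - S i w))%R%:E.
Proof.
move=> K0 expE.
pose s (n : nat) : seq ('rV[R]_d * R) := [:: (t, - n%:R)%R].
have tails : \forall w \ae P2, forall n, exists m, forall i, (m <= i)%N ->
    ~ exceeds (@shifted_value R d) (s n) ((S i w, U i w), G i w).
  by apply: ae_foralln => n; apply: M3_eventually_miss; rewrite expE ltry.
pose miss n := [set w | forall i,
  ~ exceeds (@shifted_value R d) (s n) ((S i w, U i w), G i w)].
have mmiss n : measurable (miss n).
  exact: (measurable_miss measurable_M3_point (measurable_exceeds_shifted _)).
have hit : \forall w \ae P2, ~ (\bigcap_n miss n) w.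
  exists (\bigcap_n miss n); split.
  - exact: bigcapT_measurable.
  - apply/eqP; rewrite eq_le measure_ge0 andbT.
    have lim0 : P2 (miss n) @[n --> \oo] --> expeN +oo.
      rewrite (_ : (fun n => _) = fun n => expeN (expR n%:R * K)%:E); last first.
        by apply/funext => n; rewrite -(opprK n%:R) -expE; exact: M3_void.
      apply: cvg_expeN => //; apply/cvgeyPge => A; near=> n.
      rewrite lee_fin -ler_pdivrMr//.
      apply: (@le_trans _ _ (1 + n%:R)%R); last exact: expR_ge1Dx.
      apply: (@le_trans _ _ n%:R); last by rewrite lerDr.
      near: n; exact: nbhs_infty_ger.
    rewrite -[leRHS](cvg_lim _ lim0)//; apply: lime_ge.
      by apply/cvg_ex; exists (expeN +oo).
    apply: nearW => n; apply: le_measure; rewrite ?inE//.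
      exact: bigcapT_measurable.
    by move=> w /(_ n Logic.I).
  - by move=> w /= /contrapT.
apply: filterS2 tails hit => w tailw hitw.
have [n [i0 [[t' y'] /= p_s lt]]] : exists n i, exceeds (@shifted_value R d) (s n)
    ((S i w, U i w), G i w).
  apply: contrapT => nhit; apply: hitw => n _ i ex; apply: nhit.
  by exists n, i.
have [m tailm] := tailw n.
move: p_s lt; rewrite inE => /eqP[-> ->] lt.
apply: (ereal_sup_attained (n := m) lt) => i mi ex.
by apply: (tailm i mi); exists (t, - n%:R)%R; rewrite ?mem_head.
Unshelve. all: by end_near. Qed.

End mixed_moving_maxima.

(** * Brown-Resnick processes as mixed moving maxima *)

Theorem mainTheorem6 (R : realType) (d : nat) (d_gt0 : (0 < d)%N)
    (d0 : measure_display) (T0 : measurableType d0) (P0 : probability T0 R)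
    (W : {RV P0 >-> C_Rd R d})
    (gamma sigma2 : 'rV[R]_d -> R)
    (W_gauss : gaussian_field P0 (fun t w => W w t))
    (W_stat : intrinsically_stationary P0 (fun t w => W w t))
    (W_vario : forall h, variogram P0 (fun t w => W w t) h = (gamma h)%:E)
    (W_mean : forall t, 'E_P0[fun w => W w t]%E = 0%E)
    (W_var : forall t, 'V_P0[fun w => W w t]%E = (sigma2 t)%:E)
    (W_lim : \forall w \ae P0, forall A : R, exists r : R,
       forall t : 'rV[R]_d, r < `|t| -> W w t - sigma2 t / 2 < A)
    (d1 : measure_display) (T1 : measurableType d1) (P1 : probability T1 R)
    (W1 : nat -> {RV P1 >-> C_Rd R d}) (X1 : nat -> T1 -> R)
    (sys1 : BR_system W W1 X1)
    (Tm : nat -> T1 -> 'rV[R]_d) (M : nat -> T1 -> R)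
    (F : nat -> T1 -> C_Rd R d)
    (TmP : forall i, \forall w \ae P1,
       is_lex_argsup (fun t => W1 i w t - sigma2 t / 2) (Tm i w))
    (MP : forall i, \forall w \ae P1,
       M i w = sup (range (fun t => W1 i w t - sigma2 t / 2)))
    (FP : forall i, \forall w \ae P1, forall t,
       F i w t = W1 i w (t + Tm i w) - sigma2 (t + Tm i w) / 2 - M i w)
    (lambda : R) (Q : probability (C_Rd R d) R) (lambda_gt0 : 0 < lambda)
    (lambdaQ : poisson_process P1
       (fun i w => (Tm i w, X1 i w + M i w, F i w))
       (fun A => lambda%:E *
          ((lebesgue_rV R d \x @expN_measure R) \x Q) A)%E)
    (d2 : measure_display) (T2 : measurableType d2) (P2 : probability T2 R)
    (S : nat -> T2 -> 'rV[R]_d) (U : nat -> T2 -> R)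
    (G : nat -> {RV P2 >-> C_Rd R d})
    (PiP : poisson_process P2 (fun i w => (S i w, U i w))
       (fun A => lambda%:E * (lebesgue_rV R d \x @expN_measure R) A)%E)
    (G_law : forall i A, measurable A -> distribution P2 (G i) A = Q A)
    (G_indep : indep_of_seq P2 (fun i w => (S i w, U i w)) G)
    (d3 : measure_display) (T3 : measurableType d3) (P3 : probability T3 R)
    (W3 : nat -> {RV P3 >-> C_Rd R d}) (X3 : nat -> T3 -> R)
    (sys3 : BR_system W W3 X3) :
  let Z4 := fun (t : 'rV[R]_d) w =>
    ereal_sup (range (fun i => (U i w + G i w (t - S i w))%:E)) in
  let Z := fun (t : 'rV[R]_d) w =>
    ereal_sup (range (fun i => (X3 i w + (W3 i w t - sigma2 t / 2))%:E)) in
  (forall t, \forall w \ae P2, exists i,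
     Z4 t w = (U i w + G i w (t - S i w))%:E) /\
  equal_fdd P2 P3 Z4 Z.
Proof.
move=> Z4 Z.
pose drift (t : 'rV[R]_d) := sigma2 t / 2.
(* both exponents agree, so the two maxima have the same void probabilities *)
have expE s : M3_exponent lambda Q s = BR_exponent drift W s.
  exact: (M3_exponentE lambda_gt0 sys1 FP lambdaQ).
split=> [t|].
  have mWt : measurable_fun setT (fun w => W w t).
    exact: (measurableT_comp (measurable_eval_at t)).
  have gaussWt : gaussian_rv P0 (fun w => W w t).
    have := W_gauss 1%N (fun=> t) (fun=> 1).
    by under eq_fun do rewrite big_ord1 mul1r.
  have momfin := gaussian_exp_moment mWt gaussWt.
  have momgt0 := exp_moment_gt0 P0 mWt.
  pose k := fine (\int[P0]_w (expR (W w t))%:E)%E.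
  have kE : (\int[P0]_w (expR (W w t))%:E = k%:E)%E.
    by rewrite fineK// ge0_fin_numE// ltW.
  have k0 : 0 < k by rewrite -lte_fin -kE.
  apply: (M3_attained lambda_gt0 PiP G_law G_indep (K := expR (- drift t) * k)).
    by rewrite mulr_gt0 ?expR_gt0.
  by move=> y; rewrite expE BR_exponent1 kE -EFinM expRD mulrA.
apply: equal_fdd_cdf.
- move=> t; apply: (measurable_sup_family (V := fun i t w => U i w + G i w (t - S i w))).
  move=> i {}t; exact: (measurableT_comp (measurable_shifted_value t)
    (measurable_M3_point lambda_gt0 G PiP i)).
- move=> t; apply: (measurable_sup_family
    (V := fun i t w => X3 i w + (W3 i w t - drift t))).
  move=> i {}t; exact: (measurableT_comp (measurable_spectral_value drift t)
    (measurable_BR_point sys3 i)).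
(* a joint distribution function is the probability of missing exceedances *)
move=> s.
transitivity (P2 [set w | forall i,
    ~ exceeds (@shifted_value R d) s ((S i w, U i w), G i w)]).
  congr (P2 _); apply/seteqP.
  pose pt w i := ((S i w, U i w), G i w : C_Rd R d).
  by split => w; have [] := sup_le_thresholds (@shifted_value R d) (pt w) s.
rewrite (M3_void lambda_gt0 PiP G_law G_indep) expE -(BR_void drift sys3).
congr (P3 _); apply/seteqP.
pose pt w i := (X3 i w, W3 i w : C_Rd R d).
by split => w; have [] := sup_le_thresholds (spectral_value drift) (pt w) s.
Qed.
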